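(* Let $g\in C^\omega(\mathbb{R})$ with $g(v)>0$ for $v>0$, let $\beta\in\mathbb{R}$, and let $y$ be a maximal solution of the toy model with parameter $\beta$. The following are equivalent: (1) $y$ is a toy tip solution up to a translation of the independent variable (i.e. $s\mapsto y(s+c)$ is a toy tip solution for some constant $c$); (2) $\mathrm{range}(y)=W^{\rm tip}_\beta$.
   Context: Toy model: $\rho'=\frac32\frac{1-\rho^2}{r}\Big(-1+\frac{\sqrt{1-\rho^2}(\beta r^2g(r^2)+\rho)}{r}\Big)$, $r'=\rho$ on $M_0=(-1,1)\times\mathbb{R}_{>0}$, with flow $\phi_\beta$. A toy tip solution is a solution $(\rho,r)$ on an interval $(0,s_{\max})$ with: $\lim_{s\to0^+}\rho=1$, $\lim r=0$, $\lim\sqrt{1-\rho^2}/r=\eta_0>0$; there exist $s_0>0$ and real-analytic $G:(-a,a)\to\mathbb{R}_{>0}$, $a=r(s_0)^2$, with $\rho(s)=G(r(s)^2)$ on $(0,s_0)$; and $\rho'<0,\rho>0$ on some $(0,s_0)$. $M_1=(0,1)\times\mathbb{R}_{>0}$; $N_1=\{(\eta,w)\in\mathbb{R}_{>0}\times\mathbb{R}:\eta^2w<1\}$; $N_0=\{(\eta,w)\in N_1:w>0\}$; $\Phi:M_1\to N_0$, $\Phi(\rho,r)=(\sqrt{1-\rho^2}/r,r^2)$. The $(\eta,w)$-system: $\frac{d\eta}{dt}=\frac{\eta}{2}(1-3\eta\sqrt{1-\eta^2w})-\frac32\beta\eta^2wg(w)$, $\frac{dw}{dt}=2w$, with saddle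 equilibrium $q_0=(1/3,0)$ and unstable manifold $W^u_\beta(q_0)$. Define $W^{\rm loc}_\beta=\Phi^{-1}(W^u_\beta(q_0)\cap N_0)$ and $W^{\rm tip}_\beta=\{y_0\in M_0:\exists s_0\in\mathbb{R},\ \phi_\beta(y_0;s_0)\in W^{\rm loc}_\beta\}$. *)

(* Defs.v *)
From Stdlib Require Import Reals Lra.
Open Scope R_scope.

Definition analytic_on (U : R -> Prop) (f : R -> R) : Prop :=
  forall x0, U x0 -> exists (rad : R) (a : nat -> R), 0 < rad /\
    forall x, Rabs (x - x0) < rad -> infinite_sum (fun n => a n * (x - x0) ^ n) (f x).

Definition in_oint (lo hi : option R) (s : R) : Prop :=
  match lo with Some a => a < s | None => True end /\
  match hi with Some b => s < b | None => True end.

Definition toyF (beta : R) (g : R -> R) (rho r : R) : R :=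
  3 / 2 * (1 - rho ^ 2) / r *
    (-1 + sqrt (1 - rho ^ 2) * (beta * r ^ 2 * g (r ^ 2) + rho) / r).

Definition inM0 (rho r : R) : Prop := -1 < rho < 1 /\ 0 < r.

Definition toy_sol (beta : R) (g : R -> R) (D : R -> Prop) (rho r : R -> R) : Prop :=
  forall s, D s ->
    inM0 (rho s) (r s) /\
    derivable_pt_lim rho s (toyF beta g (rho s) (r s)) /\
    derivable_pt_lim r s (rho s).

Definition toy_max_sol (beta : R) (g : R -> R) (lo hi : option R) (rho r : R -> R) : Prop :=
  (exists s, in_oint lo hi s) /\
  toy_sol beta g (in_oint lo hi) rho r /\
  forall lo' hi' rho' r',
    toy_sol beta g (in_oint lo' hi') rho' r' ->
    (forall s, in_oint lo hi s -> in_oint lo' hi' s /\ rho' s = rho s /\ r' s = r s) ->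
    forall s, in_oint lo' hi' s -> in_oint lo hi s.

Definition etaF (beta : R) (g : R -> R) (eta w : R) : R :=
  eta / 2 * (1 - 3 * eta * sqrt (1 - eta ^ 2 * w)) - 3 / 2 * beta * eta ^ 2 * w * g w.

Definition inN1 (eta w : R) : Prop := 0 < eta /\ eta ^ 2 * w < 1.
Definition inN0 (eta w : R) : Prop := inN1 eta w /\ 0 < w.

(** Unstable manifold W^u_beta(q0), q0 = (1/3, 0): points of N1 whose backward
    orbit exists for all negative times and tends to q0 as t -> -oo. *)
Definition Wu (beta : R) (g : R -> R) (p q : R) : Prop :=
  inN1 p q /\
  exists (T : R) (eta w : R -> R), 0 < T /\ eta 0 = p /\ w 0 = q /\
    (forall t, t < T ->
       inN1 (eta t) (w t) /\
       derivable_pt_lim eta t (etaF beta g (eta t) (w t)) /\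
       derivable_pt_lim w t (2 * w t)) /\
    (forall eps, 0 < eps -> exists t0, forall t, t < t0 ->
       Rabs (eta t - 1 / 3) < eps /\ Rabs (w t) < eps).

(** Phi : M1 -> N0, Phi(rho, r) = (sqrt(1-rho^2)/r, r^2);  W^loc = Phi^{-1}(W^u cap N0). *)
Definition Wloc (beta : R) (g : R -> R) (rho r : R) : Prop :=
  (0 < rho < 1 /\ 0 < r) /\
  Wu beta g (sqrt (1 - rho ^ 2) / r) (r ^ 2) /\
  inN0 (sqrt (1 - rho ^ 2) / r) (r ^ 2).

Definition Wtip (beta : R) (g : R -> R) (y1 y2 : R) : Prop :=
  inM0 y1 y2 /\
  exists lo hi rho r s0,
    toy_max_sol beta g lo hi rho r /\ in_oint lo hi 0 /\ rho 0 = y1 /\ r 0 = y2 /\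
    in_oint lo hi s0 /\ Wloc beta g (rho s0) (r s0).

Definition lim_right0 (f : R -> R) (L : R) : Prop :=
  forall eps, 0 < eps -> exists del, 0 < del /\
    forall s, 0 < s < del -> Rabs (f s - L) < eps.

Definition toy_tip (beta : R) (g : R -> R) (D : R -> Prop) (rho r : R -> R) : Prop :=
  exists smax : option R,
    (forall s, D s <-> in_oint (Some 0) smax s) /\
    (exists s, D s) /\
    toy_sol beta g D rho r /\
    lim_right0 rho 1 /\
    lim_right0 r 0 /\
    (exists eta0, 0 < eta0 /\ lim_right0 (fun s => sqrt (1 - rho s ^ 2) / r s) eta0) /\
    (exists (s0 : R) (G : R -> R),
       0 < s0 /\ D s0 /\
       analytic_on (fun x => - (r s0 ^ 2) < x < r s0 ^ 2) G /\
       (forall x, - (r s0 ^ 2) < x < r s0 ^ 2 -> 0 < G x) /\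
       (forall s, 0 < s < s0 -> rho s = G (r s ^ 2))) /\
    (exists s1, 0 < s1 /\ forall s, 0 < s < s1 ->
       D s /\ 0 < rho s /\ exists d, derivable_pt_lim rho s d /\ d < 0).

(* Main.v *)
(* In the coordinates eta = sqrt (1 - rho^2) / r, w = r^2 the toy model becomes, after a
   change of time, the (eta, w)-system, and a trajectory with rho > 0 becomes a graph
   eta = h(w) ("profile") solving the singular equation 2 w h'(w) = etaF (h(w), w).
   At w = 0 this equation has an analytic solution with h(0) = 1/3, obtained by a power
   series recursion, and contraction in the eta-direction makes it the only solution
   tending to 1/3. Hence, up to translation, all maximal solutions meeting W^loc share one
   germ at r = 0, on which rho = sqrt (1 - w h^2) = G(w) with G analytic. That germ is a tip
   solution. Conversely, a tip solution gives a profile with a positive limit at w = 0,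
   which the equation forces to be 1/3, so that it meets W^loc. *)

Require Import Defs.
From Stdlib Require Import Reals Lra Lia Classical ClassicalEpsilon FunctionalExtensionality.
From Coquelicot Require Import Coquelicot.
Open Scope R_scope.

(** * Re-expansion of power series *)

(** The obstacle is the tip itself: the toy model divides by r, so its local theory says nothing at
    r = 0. Uniqueness and continuation are therefore used only where r > 0, and what happens at r =
    0 is decided by the profile. Once rho = P(r) is known, time is recovered from the scalar
    equation r' = P(r). This equation is regular across r = 0, since P(r) = G(r^2) is even and
    continuous with P(0) = 1; it is solved by quadrature, and the tip is left at a finite time. The
    square root is kept out of the recursion by a second unknown sigma with sqrt(1 - eta^2 w) = 1 -
    w sigma. Squaring gives a quadratic equation for sigma, so the recursion is polynomial in both
    unknowns and the coefficients of g. It never divides by 0: the exponents at the saddle are 2 and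
    -1/2, so the factor at order n + 1 is 2 (n + 1) + 1/2 > 0. Convergence comes from bounds on
    weighted partial sums that reproduce themselves under the recursion. Orbits are compared through
    single points: a maximal solution contains a translate of every solution that shares a phase
    point with it. *)

Lemma CV_radius_ge_of_ex_series (a : nat -> R) (y : R) :
  ex_series (fun n => a n * y ^ n) -> Rbar_le (Rabs y) (CV_radius a).
Proof.
  intros H. apply Rbar_not_lt_le. intros Hlt.
  exact (CV_disk_outside a y Hlt (ex_series_lim_0 _ H)).
Qed.

Lemma analytic_on_PSeries (U : R -> Prop) (f : R -> R) (x0 : R) :
  analytic_on U f -> U x0 ->
  exists (rad : R) (a : nat -> R), 0 < rad /\
    forall x, Rabs (x - x0) < rad ->
      Rbar_lt (Rabs (x - x0)) (CV_radius a) /\ f x = PSeries a (x - x0).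
Proof.
  intros H Hx0. destruct (H x0 Hx0) as (rad & a & Hrad & Ha).
  exists rad, a. split; [exact Hrad|]. intros x Hx. split.
  (* The midpoint of |x - x0| and [rad]: convergence at distance d bounds the radius of convergence
     below by d, which exceeds |x - x0| strictly. *)
  - set (d := (Rabs (x - x0) + rad) / 2).
    assert (Hd : Rabs d = d).
    { apply Rabs_pos_eq. pose proof (Rabs_pos (x - x0)). unfold d; lra. }
    apply Rbar_lt_le_trans with (Rabs d).
    + simpl. rewrite Hd. unfold d; lra.
    + apply CV_radius_ge_of_ex_series. exists (f (x0 + d)).
      apply is_series_Reals.
      replace (fun n => a n * d ^ n) with (fun n => a n * (x0 + d - x0) ^ n).
      * apply Ha. replace (x0 + d - x0) with d by ring. rewrite Hd. unfold d; lra.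
      * apply functional_extensionality. intros n.
        replace (x0 + d - x0) with d by ring. reflexivity.
  - symmetry. apply is_pseries_unique. apply is_pseries_R, is_series_Reals. apply Ha, Hx.
Qed.

Lemma locally_Rabs_lt (x0 rad y : R) :
  Rabs (y - x0) < rad -> locally y (fun z => Rabs (z - x0) < rad).
Proof.
  intros H. assert (Hp : 0 < rad - Rabs (y - x0)) by lra.
  exists (mkposreal _ Hp). intros z Hz.
  change (Rabs (z - y) < rad - Rabs (y - x0)) in Hz.
  replace (z - x0) with ((z - y) + (y - x0)) by ring.
  pose proof (Rabs_triang (z - y) (y - x0)). lra.
Qed.

Lemma is_derive_PSeries_shift (a : nat -> R) (x0 y : R) :
  Rbar_lt (Rabs (y - x0)) (CV_radius a) ->
  is_derive (fun z => PSeries a (z - x0)) y (PSeries (PS_derive a) (y - x0)).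
Proof.
  intros H.
  evar_last.
  - apply (is_derive_comp (PSeries a) (fun z => z - x0)).
    + apply is_derive_PSeries, H.
    + auto_derive; [trivial|reflexivity].
  - unfold scal; simpl; unfold mult; simpl. ring.
Qed.

Lemma analytic_on_ex_derive (U : R -> Prop) (f : R -> R) (x0 : R) :
  analytic_on U f -> U x0 -> ex_derive f x0.
Proof.
  intros H Hx0. destruct (analytic_on_PSeries U f x0 H Hx0) as (rad & a & Hrad & Ha).
  assert (H0 : Rabs (x0 - x0) < rad) by (rewrite Rminus_diag, Rabs_R0; exact Hrad).
  exists (PSeries (PS_derive a) (x0 - x0)).
  apply (is_derive_ext_loc (fun z => PSeries a (z - x0))).
  - apply (filter_imp (fun z => Rabs (z - x0) < rad)).
    + intros z Hz. symmetry. apply Ha, Hz.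
    + apply locally_Rabs_lt, H0.
  - apply is_derive_PSeries_shift, Ha, H0.
Qed.

Lemma analytic_on_continuous_Derive (f : R -> R) (x0 : R) :
  analytic_on (fun _ => True) f -> continuous (Derive f) x0.
Proof.
  intros H. destruct (analytic_on_PSeries _ f x0 H I) as (rad & a & Hrad & Ha).
  assert (H0 : Rabs (x0 - x0) < rad) by (rewrite Rminus_diag, Rabs_R0; exact Hrad).
  apply (continuous_ext_loc _ (fun z => PSeries (PS_derive a) (z - x0))).
  - apply (filter_imp (fun z => Rabs (z - x0) < rad)); [|apply locally_Rabs_lt, H0].
    intros y Hy. symmetry. apply is_derive_unique.
    apply (is_derive_ext_loc (fun z => PSeries a (z - x0))).
    + apply (filter_imp (fun z => Rabs (z - x0) < rad)).
      * intros z Hz. symmetry. apply Ha, Hz.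
      * apply locally_Rabs_lt, Hy.
    + apply is_derive_PSeries_shift, Ha, Hy.
  - apply (ex_derive_continuous (fun z => PSeries (PS_derive a) (z - x0))).
    eexists. apply is_derive_PSeries_shift. rewrite CV_radius_derive. apply Ha, H0.
Qed.

(** Coefficient of h^n in (x0 + h)^m. The test matters: for n > m the truncated subtraction would
    leave a nonzero value. *)
Definition shift_coef (x0 : R) (m n : nat) : R :=
  if Nat.leb n m then Binomial.C m n * x0 ^ (m - n) else 0.

Lemma binomial_C_pos (m n : nat) : 0 <= Binomial.C m n.
Proof.
  unfold Binomial.C. apply Rlt_le, Rdiv_lt_0_compat; [apply INR_fact_lt_0|].
  apply Rmult_lt_0_compat; apply INR_fact_lt_0.
Qed.

Lemma sum_f_R0_ge_term (u : nat -> R) (k n : nat) :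
  (forall i, 0 <= u i) -> (k <= n)%nat -> u k <= sum_f_R0 u n.
Proof.
  intros Hu. induction n as [|n IH]; intros Hk.
  - assert (k = 0)%nat by lia. subst. simpl. lra.
  - simpl. destruct (Nat.eq_dec k (S n)) as [->|Hne].
    + pose proof (cond_pos_sum u n Hu). lra.
    + assert (k <= n)%nat by lia. specialize (IH H). pose proof (Hu (S n)). lra.
Qed.

(** The left-hand side is at most one term of the binomial expansion of the right-hand side, whose
    terms are all nonnegative. *)
Lemma shift_coef_bound (x0 tau : R) (m n : nat) :
  0 <= tau -> Rabs (shift_coef x0 m n) * tau ^ n <= (Rabs x0 + tau) ^ m.
Proof.
  intros Ht. unfold shift_coef. pose proof (Rabs_pos x0) as Hx.
  destruct (Nat.leb_spec n m) as [Hle|Hgt].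
  - rewrite Rplus_comm, binomial.
    rewrite Rabs_mult, (Rabs_pos_eq (Binomial.C m n)), <- RPow_abs by apply binomial_C_pos.
    pose proof (sum_f_R0_ge_term
      (fun i => Binomial.C m i * tau ^ i * Rabs x0 ^ (m - i)) n m) as Hs.
    cbv beta in Hs. eapply Rle_trans; [|apply Hs; [|exact Hle]].
    + right; ring.
    + intros i. apply Rmult_le_pos; [apply Rmult_le_pos|].
      * apply binomial_C_pos.
      * apply pow_le, Ht.
      * apply pow_le, Hx.
  - rewrite Rabs_R0, Rmult_0_l. apply pow_le. lra.
Qed.

Lemma shift_coef_sum (x0 h : R) (m N : nat) :
  (m <= N)%nat -> sum_f_R0 (fun n => shift_coef x0 m n * h ^ n) N = (h + x0) ^ m.
Proof.
  intros H. induction N as [|N IH].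
  - assert (m = 0)%nat by lia. subst. unfold shift_coef. simpl. unfold Binomial.C. simpl. field.
  - destruct (Nat.eq_dec m (S N)) as [->|Hne].
    + rewrite binomial. apply sum_eq. intros i Hi. unfold shift_coef.
      destruct (Nat.leb_spec i (S N)); [ring|lia].
    + simpl sum_f_R0. rewrite IH by lia. unfold shift_coef.
      destruct (Nat.leb_spec (S N) m); [lia|ring].
Qed.

(* The tail of the binomial expansion is estimated termwise: for |h| <= tau/2 its
   n-th term is at most (1/2)^n (|x0| + tau)^m. *)
Lemma shift_coef_tail (x0 h tau : R) (m N : nat) :
  0 < tau -> Rabs h <= tau / 2 ->
  Rabs ((h + x0) ^ m - sum_f_R0 (fun n => shift_coef x0 m n * h ^ n) N)
    <= (1 / 2) ^ N * (Rabs x0 + tau) ^ m.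
Proof.
  intros Ht Hh.
  assert (Hm : 0 <= (Rabs x0 + tau) ^ m) by (apply pow_le; pose proof (Rabs_pos x0); lra).
  assert (Hterm : forall n, Rabs (shift_coef x0 m n * h ^ n)
                            <= (1 / 2) ^ n * (Rabs x0 + tau) ^ m).
  { intros n. pose proof (shift_coef_bound x0 tau m n (Rlt_le _ _ Ht)) as Hb.
    rewrite Rabs_mult, <- RPow_abs.
    assert (Hp : Rabs h ^ n <= (1 / 2) ^ n * tau ^ n).
    { rewrite <- Rpow_mult_distr. apply pow_incr. split; [apply Rabs_pos|lra]. }
    pose proof (Rabs_pos (shift_coef x0 m n)) as Hc.
    assert (0 <= (1 / 2) ^ n) by (apply pow_le; lra).
    apply Rle_trans with ((1/2) ^ n * (Rabs (shift_coef x0 m n) * tau ^ n)).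
    - apply Rle_trans with (Rabs (shift_coef x0 m n) * ((1 / 2) ^ n * tau ^ n)).
      + apply Rmult_le_compat_l; assumption.
      + right; ring.
    - apply Rmult_le_compat_l; assumption. }
  (* Induction downwards from m: for N' >= m the remainder is 0, and a step from N' + 1 down to N'
     adds a term no larger than the bound at N' + 1, which is half of the bound at N'. *)
  assert (Hind : forall d N', (m <= N' + d)%nat ->
    Rabs ((h + x0) ^ m - sum_f_R0 (fun n => shift_coef x0 m n * h ^ n) N')
    <= (1 / 2) ^ N' * (Rabs x0 + tau) ^ m).
  { intros d. induction d as [|d IH]; intros N' HN.
    - rewrite shift_coef_sum by lia. rewrite Rminus_diag, Rabs_R0.
      apply Rmult_le_pos; [apply pow_le; lra|exact Hm].
    - assert (HS := IH (S N') ltac:(lia)). rewrite tech5 in HS.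
      specialize (Hterm (S N')).
      set (S0 := sum_f_R0 _ N') in *. set (t := shift_coef x0 m (S N') * h ^ S N') in *.
      replace ((h + x0) ^ m - S0) with (((h + x0) ^ m - (S0 + t)) + t) by ring.
      eapply Rle_trans; [apply Rabs_triang|].
      assert (Hp : (1 / 2) ^ S N' * (Rabs x0 + tau) ^ m
                   = (1 / 2) ^ N' * (Rabs x0 + tau) ^ m / 2) by (simpl; field).
      rewrite Hp in HS, Hterm. lra. }
  apply (Hind m N). lia.
Qed.

Lemma ex_series_dom (a b : nat -> R) :
  (forall n, Rabs (a n) <= b n) -> ex_series b -> ex_series (fun n => Rabs (a n)).
Proof.
  intros H Hb. apply (ex_series_le (fun n => Rabs (a n)) b); [|exact Hb].
  intros n. change (Rabs (Rabs (a n)) <= b n). rewrite Rabs_Rabsolu. apply H.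
Qed.

Lemma Series_sum_f_R0 (u : nat -> nat -> R) (N : nat) :
  (forall n, ex_series (fun m => u n m)) ->
  ex_series (fun m => sum_f_R0 (fun n => u n m) N) /\
  Series (fun m => sum_f_R0 (fun n => u n m) N) = sum_f_R0 (fun n => Series (u n)) N.
Proof.
  intros Hu. induction N as [|N [IH1 IH2]]; simpl.
  - split; [apply Hu|reflexivity].
  - split.
    + apply (ex_series_plus (V := R_NormedModule)
        (fun m => sum_f_R0 (fun n => u n m) N) (fun m => u (S N) m)); [exact IH1|apply Hu].
    + rewrite Series_plus; [|exact IH1|apply Hu]. rewrite IH2. reflexivity.
Qed.

(** No double series is rearranged: a finite sum over n commutes with the series over m, and
    [shift_coef_tail], summed against |a m|, leaves an error of at most (1/2)^N A, where A is the
    sum of the dominating series. *)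
Lemma PSeries_analytic_on (a : nat -> R) (eps : R) :
  ex_series (fun n => Rabs (a n) * eps ^ n) ->
  analytic_on (fun x => - eps < x < eps) (PSeries a).
Proof.
  intros Ha x0 Hx0.
  assert (Hx0' : Rabs x0 < eps) by (apply Rabs_def1; lra).
  set (tau := eps - Rabs x0).
  assert (Ht : 0 < tau) by (unfold tau; lra).
  exists (tau / 2), (fun n => Series (fun m => a m * shift_coef x0 m n)).
  split; [lra|]. intros x Hx. set (h := x - x0) in *.
  assert (Heps : Rabs x0 + tau = eps) by (unfold tau; ring).
  assert (Hex : forall n, ex_series (fun m => a m * shift_coef x0 m n * h ^ n)).
  { intros n. apply ex_series_Rabs.
    apply ex_series_dom with (fun m => Rabs (a m) * eps ^ m); [|exact Ha].
    intros m. rewrite Rmult_assoc, Rabs_mult.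
    apply Rmult_le_compat_l; [apply Rabs_pos|].
    rewrite Rabs_mult, <- RPow_abs, <- Heps.
    eapply Rle_trans; [|apply (shift_coef_bound x0 tau m n); lra].
    apply Rmult_le_compat_l; [apply Rabs_pos|]. apply pow_incr.
    split; [apply Rabs_pos|lra]. }
  assert (Hexx : ex_series (fun m => a m * x ^ m)).
  { apply ex_series_Rabs.
    apply ex_series_dom with (fun m => Rabs (a m) * eps ^ m); [|exact Ha].
    intros m. rewrite Rabs_mult, <- RPow_abs.
    apply Rmult_le_compat_l; [apply Rabs_pos|]. apply pow_incr.
    split; [apply Rabs_pos|]. replace x with (h + x0) by (unfold h; ring).
    pose proof (Rabs_triang h x0). lra. }
  set (A := Series (fun n => Rabs (a n) * eps ^ n)).
  assert (Hmain : forall N,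
    Rabs (sum_f_R0 (fun n => Series (fun m => a m * shift_coef x0 m n) * h ^ n) N
          - PSeries a x) <= (1 / 2) ^ N * A).
  { intros N.
    destruct (Series_sum_f_R0 (fun n m => a m * shift_coef x0 m n * h ^ n) N Hex) as [HS1 HS2].
    rewrite (sum_eq _ (fun n => Series (fun m => a m * shift_coef x0 m n * h ^ n)) N)
      by (intros; symmetry; apply Series_scal_r).
    rewrite <- HS2. unfold PSeries. rewrite <- Series_minus by assumption.
    assert (Hb : forall m, Rabs (sum_f_R0 (fun n => a m * shift_coef x0 m n * h ^ n) N
                                 - a m * x ^ m)
                           <= (1 / 2) ^ N * (Rabs (a m) * eps ^ m)).
    { intros m.
      rewrite (sum_eq _ (fun n => shift_coef x0 m n * h ^ n * a m) N) by (intros; ring).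
      rewrite <- scal_sum.
      replace x with (h + x0) by (unfold h; ring).
      rewrite <- Rmult_minus_distr_l, Rabs_mult, Rabs_minus_sym.
      rewrite (Rmult_comm ((1/2)^N)), Rmult_assoc.
      apply Rmult_le_compat_l; [apply Rabs_pos|].
      rewrite Rmult_comm, <- Heps. apply Rlt_le in Hx.
      pose proof (shift_coef_tail x0 h tau m N Ht Hx). lra. }
    assert (Hexb : ex_series (fun m => (1 / 2) ^ N * (Rabs (a m) * eps ^ m))).
    { apply (ex_series_scal (V := R_NormedModule) ((1/2)^N)). exact Ha. }
    eapply Rle_trans; [apply Series_Rabs|].
    - eapply ex_series_dom; [exact Hb|exact Hexb].
    - unfold A. rewrite <- Series_scal_l. apply Series_le; [|exact Hexb].
      intros m. split; [apply Rabs_pos|apply Hb]. }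
  assert (HA : 0 <= A).
  { specialize (Hmain 0%nat). simpl in Hmain.
    pose proof (Rabs_pos (Series (fun m => a m * shift_coef x0 m 0) * 1 - PSeries a x)). lra. }
  intros e He.
  destruct (pow_lt_1_zero (1/2)) with (y := e / (A + 1)) as [N HN].
  { rewrite Rabs_pos_eq; lra. }
  { apply Rdiv_lt_0_compat; lra. }
  exists N. intros n Hn. unfold Rdist. eapply Rle_lt_trans; [apply Hmain|].
  specialize (HN n Hn). rewrite Rabs_pos_eq in HN by (apply pow_le; lra).
  apply Rle_lt_trans with ((1/2)^n * (A + 1)).
  - apply Rmult_le_compat_l; [apply pow_le; lra|lra].
  - apply Rlt_le_trans with (e / (A + 1) * (A + 1)).
    + apply Rmult_lt_compat_r; lra.
    + right. field. lra.
Qed.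

(** * The analytic solution at the saddle *)

(** Below n, the approximation [F n] no longer changes when n grows, because [Phi] at n reads only
    smaller indices. The diagonal value F (n + 1) n is thus a fixed point, and the default d never
    influences it. *)
Lemma course_of_values_fixpoint {A : Type} (d : A) (Phi : (nat -> A) -> nat -> A) :
  (forall f f' n, (forall k, (k < n)%nat -> f k = f' k) -> Phi f n = Phi f' n) ->
  exists f, forall n, f n = Phi f n.
Proof.
  intros Hloc.
  set (F := fix F (n : nat) : nat -> A :=
              match n with O => fun _ => d | S m => Phi (F m) end).
  assert (Hst : forall n m k, (k < n)%nat -> (k < m)%nat -> F n k = F m k).
  { intros n. induction n as [|n IH]; intros m k Hn Hm; [lia|].
    destruct m as [|m]; [lia|]. simpl. apply Hloc. intros j Hj. apply IH; lia. }
  exists (fun n => F (S n) n). intros n.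
  change (F (S n) n) with (Phi (F n) n). apply Hloc.
  intros k Hk. apply Hst; lia.
Qed.

(** Partial sum of a weighted l1 norm, which is submultiplicative for the Cauchy product. Truncation
    at n permits induction on n before convergence is known. *)
Definition wsum (eps : R) (a : nat -> R) (n : nat) : R :=
  sum_f_R0 (fun k => Rabs (a k) * eps ^ k) n.

Lemma wsum_term_pos (eps : R) (a : nat -> R) (k : nat) :
  0 <= eps -> 0 <= Rabs (a k) * eps ^ k.
Proof. intros H. apply Rmult_le_pos; [apply Rabs_pos|apply pow_le, H]. Qed.

Lemma wsum_pos (eps : R) (a : nat -> R) (n : nat) : 0 <= eps -> 0 <= wsum eps a n.
Proof. intros H. apply cond_pos_sum. intros k. apply wsum_term_pos, H. Qed.

(** The product of two partial sums is the truncated Cauchy product plus the remaining products, all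
    nonnegative. *)
Lemma sum_f_R0_mult_le (x y : nat -> R) (n : nat) :
  (forall k, 0 <= x k) -> (forall k, 0 <= y k) ->
  sum_f_R0 (PS_mult x y) n <= sum_f_R0 x n * sum_f_R0 y n.
Proof.
  intros Hx Hy. destruct n as [|n].
  - unfold PS_mult. simpl. lra.
  - rewrite cauchy_finite by lia. unfold PS_mult.
    match goal with |- _ <= _ + ?s => assert (0 <= s) end.
    { apply cond_pos_sum. intros k. apply cond_pos_sum. intros l.
      apply Rmult_le_pos; [apply Hx|apply Hy]. }
    lra.
Qed.

Lemma wsum_mult (eps : R) (a b : nat -> R) (n : nat) :
  0 <= eps -> wsum eps (PS_mult a b) n <= wsum eps a n * wsum eps b n.
Proof.
  intros He. eapply Rle_trans; [|apply sum_f_R0_mult_le; intros; apply wsum_term_pos, He].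
  apply sum_Rle. intros k _. unfold PS_mult.
  rewrite Rmult_comm.
  apply Rle_trans with (eps ^ k * sum_f_R0 (fun i => Rabs (a i * b (k - i)%nat)) k).
  - apply Rmult_le_compat_l; [apply pow_le, He|]. apply Rsum_abs.
  - right. rewrite scal_sum. apply sum_eq. intros i Hi.
    rewrite Rabs_mult. replace (eps ^ k) with (eps ^ i * eps ^ (k - i)); [ring|].
    rewrite <- pow_add. f_equal. lia.
Qed.

Lemma wsum_incr_S (eps : R) (a : nat -> R) (n : nat) :
  wsum eps (PS_incr_1 a) (S n) = eps * wsum eps a n.
Proof.
  unfold wsum. rewrite decomp_sum by lia. simpl pred.
  change (PS_incr_1 a 0%nat) with 0. rewrite Rabs_R0, Rmult_0_l, Rplus_0_l, scal_sum.
  apply sum_eq. intros i _. simpl. ring.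
Qed.

Lemma wsum_incr_0 (eps : R) (a : nat -> R) : wsum eps (PS_incr_1 a) 0 = 0.
Proof. change (Rabs 0 * 1 = 0). rewrite Rabs_R0. ring. Qed.

Lemma wsum_incr_le (eps : R) (a : nat -> R) (n : nat) :
  0 <= eps -> wsum eps (PS_incr_1 a) n <= eps * wsum eps a n.
Proof.
  intros He. destruct n as [|n].
  - rewrite wsum_incr_0. apply Rmult_le_pos; [exact He|apply wsum_pos, He].
  - rewrite wsum_incr_S. apply Rmult_le_compat_l; [exact He|].
    unfold wsum. simpl. pose proof (wsum_term_pos eps a (S n) He). simpl in H. lra.
Qed.

Lemma wsum_le_lin3 (eps c1 c2 c3 : R) (a b1 b2 b3 : nat -> R) (n : nat) :
  0 <= eps ->
  (forall k, Rabs (a k) <= c1 * Rabs (b1 k) + c2 * Rabs (b2 k) + c3 * Rabs (b3 k)) ->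
  wsum eps a n <= c1 * wsum eps b1 n + c2 * wsum eps b2 n + c3 * wsum eps b3 n.
Proof.
  intros He H. unfold wsum. rewrite !scal_sum, <- !plus_sum.
  apply sum_Rle. intros k _. specialize (H k).
  pose proof (pow_le eps k He).
  apply Rle_trans with ((c1 * Rabs (b1 k) + c2 * Rabs (b2 k) + c3 * Rabs (b3 k)) * eps ^ k).
  - apply Rmult_le_compat_r; assumption.
  - right; ring.
Qed.

Lemma wsum_bounded_ex_series (eps B : R) (a : nat -> R) :
  0 <= eps -> (forall n, wsum eps a n <= B) ->
  ex_series (fun n => Rabs (a n) * eps ^ n) /\
  forall x, Rabs x <= eps -> Rabs (PSeries a x) <= B.
Proof.
  intros He HB.
  assert (Hlim : ex_finite_lim_seq (sum_n (fun n => Rabs (a n) * eps ^ n))).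
  { apply ex_finite_lim_seq_incr with B.
    - intros n. rewrite !sum_n_Reals. simpl.
      pose proof (wsum_term_pos eps a (S n) He). simpl in H. lra.
    - intros n. rewrite sum_n_Reals. apply HB. }
  destruct Hlim as [l Hl].
  assert (Hs : is_series (fun n => Rabs (a n) * eps ^ n) l) by exact Hl.
  assert (Hle : l <= B).
  { apply (is_lim_seq_le _ (fun _ => B) l B) in Hl; [exact Hl| |apply is_lim_seq_const].
    intros n. rewrite sum_n_Reals. apply HB. }
  split; [exists l; exact Hs|].
  intros x Hx. unfold PSeries.
  assert (Hd : forall n, Rabs (a n * x ^ n) <= Rabs (a n) * eps ^ n).
  { intros n. rewrite Rabs_mult, <- RPow_abs.
    apply Rmult_le_compat_l; [apply Rabs_pos|]. apply pow_incr.
    split; [apply Rabs_pos|exact Hx]. }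
  eapply Rle_trans; [apply Series_Rabs; eapply ex_series_dom; [exact Hd|exists l; exact Hs]|].
  eapply Rle_trans; [apply Series_le; [|exists l; exact Hs]|].
  - intros n; split; [apply Rabs_pos|apply Hd].
  - rewrite (is_series_unique _ _ Hs). exact Hle.
Qed.

Lemma CV_radius_gt_of_abs (eps x : R) (a : nat -> R) :
  ex_series (fun n => Rabs (a n) * eps ^ n) -> Rabs x < eps ->
  Rbar_lt (Rabs x) (CV_radius a).
Proof.
  intros H Hx. pose proof (Rabs_pos x) as H0.
  apply Rbar_lt_le_trans with (Rabs eps).
  - simpl. rewrite (Rabs_pos_eq eps); lra.
  - apply CV_radius_ge_of_ex_series. apply ex_series_Rabs.
    apply ex_series_dom with (fun n => Rabs (a n) * eps ^ n); [|exact H].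
    intros n. rewrite Rabs_mult, <- RPow_abs, (Rabs_pos_eq eps) by lra. lra.
Qed.

(* With eta = 1/3 + w zeta(w) and sqrt(1 - eta^2 w) = 1 - w sigma(w), the coefficients
   of zeta and sigma are denoted z and s, and Q = eta^2. *)
Definition Qseq (z : nat -> R) (n : nat) : R :=
  match n with
  | O => 1 / 9
  | S m => 2 / 3 * z m + PS_incr_1 (PS_mult z z) m
  end.

(** Coefficients in 2 sigma = Q + w sigma^2, which is (1 - w sigma)^2 = 1 - w Q. *)
Definition sig_step (z s : nat -> R) (n : nat) : R :=
  (Qseq z n + PS_incr_1 (PS_mult s s) n) / 2.

(** Coefficients in 4 w zeta' + 5 zeta = 3 (- w zeta^2 + Q sigma - beta g Q), the profile equation
    divided by w/2. [sig_step] replaces s, so that index n refers to z and s at smaller indices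
    only. *)
Definition zeta_step (beta : R) (gs z s : nat -> R) (n : nat) : R :=
  3 / (4 * INR n + 5) *
    (- PS_incr_1 (PS_mult z z) n + PS_mult (Qseq z) (sig_step z s) n
     - beta * PS_mult gs (Qseq z) n).

Lemma PS_mult_local (a a' b b' : nat -> R) (n : nat) :
  (forall k, (k <= n)%nat -> a k = a' k) -> (forall k, (k <= n)%nat -> b k = b' k) ->
  PS_mult a b n = PS_mult a' b' n.
Proof.
  intros Ha Hb. apply sum_eq. intros i Hi. rewrite Ha, Hb by lia. reflexivity.
Qed.

Lemma PS_incr_mult_local (a a' : nat -> R) (n : nat) :
  (forall k, (k < n)%nat -> a k = a' k) ->
  PS_incr_1 (PS_mult a a) n = PS_incr_1 (PS_mult a' a') n.
Proof.
  intros Ha. destruct n as [|n]; [reflexivity|]. simpl.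
  apply PS_mult_local; intros; apply Ha; lia.
Qed.

Lemma Qseq_local (z z' : nat -> R) (n : nat) :
  (forall k, (k < n)%nat -> z k = z' k) -> Qseq z n = Qseq z' n.
Proof.
  intros H. destruct n as [|n]; [reflexivity|]. simpl.
  rewrite (H n) by lia. rewrite (PS_incr_mult_local z z'); [reflexivity|].
  intros; apply H; lia.
Qed.

Lemma sig_step_local (z z' s s' : nat -> R) (n : nat) :
  (forall k, (k < n)%nat -> z k = z' k) -> (forall k, (k < n)%nat -> s k = s' k) ->
  sig_step z s n = sig_step z' s' n.
Proof.
  intros Hz Hs. unfold sig_step.
  rewrite (Qseq_local z z' n Hz), (PS_incr_mult_local s s' n Hs). reflexivity.
Qed.

Lemma coefficients_exist (beta : R) (gs : nat -> R) :
  exists z s : nat -> R, (forall n, s n = sig_step z s n) /\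
    forall n, z n = 3 / (4 * INR n + 5) *
      (- PS_incr_1 (PS_mult z z) n + PS_mult (Qseq z) s n
       - beta * PS_mult gs (Qseq z) n).
Proof.
  destruct (course_of_values_fixpoint (0, 0) (fun f n =>
    (zeta_step beta gs (fun k => fst (f k)) (fun k => snd (f k)) n,
     sig_step (fun k => fst (f k)) (fun k => snd (f k)) n))) as [f Hf].
  { intros f f' n H.
    assert (H1 : forall k, (k < n)%nat -> fst (f k) = fst (f' k))
      by (intros k Hk; rewrite H by exact Hk; reflexivity).
    assert (H2 : forall k, (k < n)%nat -> snd (f k) = snd (f' k))
      by (intros k Hk; rewrite H by exact Hk; reflexivity).
    f_equal; [|apply sig_step_local; assumption].
    unfold zeta_step.
    rewrite (PS_incr_mult_local (fun k => fst (f k)) (fun k => fst (f' k)) n H1).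
    rewrite (PS_mult_local (Qseq (fun k => fst (f k))) (Qseq (fun k => fst (f' k)))
      (sig_step (fun k => fst (f k)) (fun k => snd (f k)))
      (sig_step (fun k => fst (f' k)) (fun k => snd (f' k))) n).
    - rewrite (PS_mult_local gs gs (Qseq (fun k => fst (f k)))
        (Qseq (fun k => fst (f' k))) n); [reflexivity|reflexivity|].
      intros k Hk. apply Qseq_local. intros; apply H1; lia.
    - intros k Hk. apply Qseq_local. intros; apply H1; lia.
    - intros k Hk. apply sig_step_local; intros; [apply H1|apply H2]; lia. }
  exists (fun k => fst (f k)), (fun k => snd (f k)).
  assert (Hs : forall n, snd (f n) = sig_step (fun k => fst (f k)) (fun k => snd (f k)) n)
    by (intros n; rewrite (Hf n) at 1; reflexivity).
  split; [exact Hs|].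
  intros n. rewrite (Hf n) at 1. simpl fst. unfold zeta_step. f_equal. f_equal. f_equal.
  apply PS_mult_local; intros; [reflexivity|symmetry; apply Hs].
Qed.

(** With B = 1 + |beta| Gam the bounds 1, 1, B reproduce themselves. Since eps B <= 1/4, the
    recursion gives at most 1/9 + (2/3)(1/4) + 1/16 < 1 for Q, (1 + eps)/2 < 1 for s and (3/5)(B/4 +
    B) < B for z. *)
Lemma coefficients_bounded (beta eps Gam : R) (gs z s : nat -> R) :
  0 < eps <= 1 / 4 -> eps * (1 + Rabs beta * Gam) <= 1 / 4 ->
  (forall n, wsum eps gs n <= Gam) ->
  (forall n, s n = sig_step z s n) ->
  (forall n, z n = 3 / (4 * INR n + 5) *
      (- PS_incr_1 (PS_mult z z) n + PS_mult (Qseq z) s n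
       - beta * PS_mult gs (Qseq z) n)) ->
  forall n, wsum eps (Qseq z) n <= 1 /\ wsum eps s n <= 1 /\
            wsum eps z n <= 1 + Rabs beta * Gam.
Proof.
  intros He HeB Hg Hs Hz. set (B := 1 + Rabs beta * Gam) in *.
  assert (He0 : 0 <= eps) by lra.
  assert (HGam : 0 <= Gam) by (pose proof (wsum_pos eps gs 0 He0); specialize (Hg 0%nat); lra).
  assert (HB : 1 <= B) by (pose proof (Rmult_le_pos _ _ (Rabs_pos beta) HGam); unfold B; lra).
  assert (Hzabs : forall k, Rabs (z k) <= 3 / 5 * Rabs (PS_incr_1 (PS_mult z z) k)
      + 3 / 5 * Rabs (PS_mult (Qseq z) s k)
      + 3 / 5 * Rabs beta * Rabs (PS_mult gs (Qseq z) k)).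
  { intros k. rewrite (Hz k) at 1. pose proof (pos_INR k) as Hk.
    set (u := PS_incr_1 (PS_mult z z) k). set (v := PS_mult (Qseq z) s k).
    set (t := PS_mult gs (Qseq z) k).
    assert (H1 : Rabs (- u + v - beta * t) <= Rabs u + Rabs v + Rabs beta * Rabs t).
    { rewrite <- Rabs_mult. replace (- u + v - beta * t) with (- u + v + - (beta * t)) by ring.
      eapply Rle_trans; [apply Rabs_triang|]. rewrite Rabs_Ropp.
      pose proof (Rabs_triang (- u) v). rewrite Rabs_Ropp in H. lra. }
    rewrite Rabs_mult.
    assert (H2 : 0 <= 3 / (4 * INR k + 5) <= 3 / 5).
    { split; [apply Rlt_le, Rdiv_lt_0_compat; lra|].
      unfold Rdiv. apply Rmult_le_compat_l; [lra|]. apply Rinv_le_contravar; lra. }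
    rewrite (Rabs_pos_eq (3 / _)) by apply H2.
    apply Rle_trans with (3 / 5 * Rabs (- u + v - beta * t)).
    - apply Rmult_le_compat_r; [apply Rabs_pos|apply H2].
    - lra. }
  assert (Hsabs : forall k, Rabs (s k) <= 1 / 2 * Rabs (Qseq z k)
      + 1 / 2 * Rabs (PS_incr_1 (PS_mult s s) k) + 0 * Rabs (z k)).
  { intros k. rewrite (Hs k) at 1. unfold sig_step, Rdiv.
    rewrite Rabs_mult, (Rabs_pos_eq (/ 2)) by lra.
    pose proof (Rabs_triang (Qseq z k) (PS_incr_1 (PS_mult s s) k)). lra. }
  (* The bounds at index n only use those at index n - 1 on the right-hand sides. *)
  assert (Hstep : forall n, wsum eps (Qseq z) n <= 1 ->
            wsum eps (PS_incr_1 (PS_mult s s)) n <= eps ->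
            wsum eps (PS_incr_1 (PS_mult z z)) n <= eps * (B * B) ->
            wsum eps (Qseq z) n <= 1 /\ wsum eps s n <= 1 /\ wsum eps z n <= B).
  { intros n HQ Hss Hzz. split; [exact HQ|].
    assert (HS : wsum eps s n <= 1).
    { eapply Rle_trans; [apply (wsum_le_lin3 eps _ _ _ _ _ _ _ n He0 Hsabs)|]. lra. }
    split; [exact HS|].
    eapply Rle_trans; [apply (wsum_le_lin3 eps _ _ _ _ _ _ _ n He0 Hzabs)|].
    pose proof (wsum_mult eps (Qseq z) s n He0) as H1.
    pose proof (wsum_mult eps gs (Qseq z) n He0) as H2.
    pose proof (wsum_pos eps (Qseq z) n He0). pose proof (wsum_pos eps s n He0).
    pose proof (wsum_pos eps gs n He0). specialize (Hg n).
    assert (K3 : wsum eps (PS_mult (Qseq z) s) n <= 1) by nra.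
    assert (K4 : wsum eps (PS_mult gs (Qseq z)) n <= Gam) by nra.
    assert (K5 : Rabs beta * wsum eps (PS_mult gs (Qseq z)) n <= Rabs beta * Gam)
      by (apply Rmult_le_compat_l; [apply Rabs_pos|exact K4]).
    assert (K6 : eps * (B * B) <= 1 / 4 * B) by nra.
    unfold B in *. lra. }
  intros n. induction n as [|n (IHQ & IHS & IHZ)].
  - apply Hstep.
    + unfold wsum. simpl. rewrite Rabs_pos_eq; lra.
    + rewrite wsum_incr_0. lra.
    + rewrite wsum_incr_0. nra.
  - pose proof (wsum_mult eps z z n He0) as Hzz. pose proof (wsum_mult eps s s n He0) as Hss.
    pose proof (wsum_pos eps z n He0) as Hz0. pose proof (wsum_pos eps s n He0) as Hs0.
    assert (Hzz' : wsum eps (PS_mult z z) n <= B * B) by nra.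
    assert (Hss' : wsum eps (PS_mult s s) n <= 1) by nra.
    apply Hstep.
    + unfold wsum. rewrite decomp_sum by lia. simpl pred.
      rewrite (sum_eq _ (fun i => (Rabs (2 / 3 * z i + PS_incr_1 (PS_mult z z) i) * eps ^ i) * eps))
        by (intros i _; simpl; ring).
      rewrite <- scal_sum.
      change (sum_f_R0 _ n) with (wsum eps (fun i => 2 / 3 * z i + PS_incr_1 (PS_mult z z) i) n).
      assert (HH : wsum eps (fun i => 2 / 3 * z i + PS_incr_1 (PS_mult z z) i) n
                   <= 2 / 3 * wsum eps z n + 1 * wsum eps (PS_incr_1 (PS_mult z z)) n
                      + 0 * wsum eps z n).
      { apply wsum_le_lin3; [exact He0|]. intros k.
        eapply Rle_trans; [apply Rabs_triang|]. rewrite Rabs_mult, (Rabs_pos_eq (2/3)) by lra. lra. }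
      pose proof (wsum_incr_le eps (PS_mult z z) n He0) as Hi.
      simpl. rewrite Rabs_pos_eq by lra.
      assert (eps * wsum eps (fun i => 2 / 3 * z i + PS_incr_1 (PS_mult z z) i) n
              <= eps * (2 / 3 * B + eps * (B * B))).
      { apply Rmult_le_compat_l; [exact He0|]. 
        assert (eps * wsum eps (PS_mult z z) n <= eps * (B * B)) by (apply Rmult_le_compat_l; lra).
        lra. }
      assert (eps * (2 / 3 * B + eps * (B * B)) = 2 / 3 * (eps * B) + (eps * B) * (eps * B)) by ring.
      assert (0 <= eps * B) by nra.
      nra.
    + rewrite wsum_incr_S. nra.
    + rewrite wsum_incr_S. apply Rmult_le_compat_l; lra.
Qed.

Lemma PSeries_cons (a : nat -> R) (c x : R) (b : nat -> R) :
  (forall n, a n = match n with O => c | S m => b m end) ->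
  Rbar_lt (Rabs x) (CV_radius b) -> PSeries a x = c + x * PSeries b x.
Proof.
  intros Ha Hx.
  assert (Hd : forall n, PS_decr_1 a n = b n) by (intros n; unfold PS_decr_1; rewrite Ha; reflexivity).
  assert (Hex : ex_pseries a x).
  { apply CV_radius_inside. rewrite <- CV_radius_decr_1, (CV_radius_ext _ b Hd). exact Hx. }
  rewrite (PSeries_decr_1 a x Hex), (Ha 0%nat), (PSeries_ext _ b x Hd). reflexivity.
Qed.

Lemma wsum_PSeries_le (a : nat -> R) (eps eps0 : R) (n : nat) :
  0 <= eps <= eps0 -> Rbar_lt (Rabs eps0) (CV_radius a) ->
  wsum eps a n <= Series (fun n => Rabs (a n * eps0 ^ n)).
Proof.
  intros He H. pose proof (CV_disk_inside a eps0 H) as Hex.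
  apply Rle_trans with (sum_f_R0 (fun n => Rabs (a n * eps0 ^ n)) n).
  - apply sum_Rle. intros k _. rewrite Rabs_mult, <- RPow_abs, (Rabs_pos_eq eps0) by lra.
    apply Rmult_le_compat_l; [apply Rabs_pos|]. apply pow_incr, He.
  - apply sum_incr; [|intros; apply Rabs_pos].
    apply is_series_Reals, Series_correct, Hex.
Qed.

(** The identities hold on both sides of w = 0: [toy_tip] wants G analytic around 0, and the lift
    that starts at r = 0 needs h to be continuous there. The equation is kept multiplied by 2 w so
    that it makes sense at w = 0. *)
Lemma analytic_profile (beta : R) (g : R -> R) :
  analytic_on (fun _ => True) g ->
  exists (eps : R) (h G : R -> R), 0 < eps /\
    analytic_on (fun x => - eps < x < eps) G /\ h 0 = 1 / 3 /\ G 0 = 1 /\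
    forall w, Rabs w < eps -> 0 < h w /\ 0 < G w /\ G w ^ 2 = 1 - h w ^ 2 * w /\
      exists d : R, is_derive h w d /\
        2 * w * d = h w / 2 * (1 - 3 * h w * G w) - 3 / 2 * beta * h w ^ 2 * w * g w.
Proof.
  intros Hg.
  destruct (analytic_on_PSeries _ g 0 Hg I) as (rad & gs & Hrad & Hgs).
  (* Strictly inside the disc of convergence of g, so that the weighted norm [Gam] of its
     coefficients is finite. *)
  set (eps0 := rad / 2).
  assert (Heps0 : Rabs eps0 = eps0) by (apply Rabs_pos_eq; unfold eps0; lra).
  assert (Hcv0 : Rbar_lt (Rabs eps0) (CV_radius gs)).
  { replace eps0 with (eps0 - 0) by ring. apply Hgs.
    rewrite Rminus_0_r, Heps0. unfold eps0; lra. }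
  set (Gam := Series (fun n => Rabs (gs n * eps0 ^ n))).
  assert (HGam : 0 <= Gam).
  { pose proof (wsum_PSeries_le gs 0 eps0 0 ltac:(unfold eps0; lra) Hcv0).
    pose proof (wsum_pos 0 gs 0 (Rle_refl 0)). unfold Gam. lra. }
  set (B := 1 + Rabs beta * Gam).
  assert (HB : 1 <= B) by (pose proof (Rmult_le_pos _ _ (Rabs_pos beta) HGam); unfold B; lra).
  set (eps := Rmin eps0 (/ (4 * B))).
  assert (Heps : 0 < eps <= 1 / 4 /\ eps <= eps0 /\ eps * B <= 1 / 4).
  { assert (0 < / (4 * B)) by (apply Rinv_0_lt_compat; lra).
    assert (H1 : eps <= / (4 * B)) by apply Rmin_r.
    assert (H2 : eps <= eps0) by apply Rmin_l.
    assert (H3 : 0 < eps) by (apply Rmin_glb_lt; [unfold eps0; lra|assumption]).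
    assert (H4 : eps * B <= 1 / 4).
    { apply Rle_trans with (/ (4 * B) * B); [apply Rmult_le_compat_r; lra|].
      right. field. lra. }
    repeat split; try assumption. nra. }
  destruct Heps as (He & He0 & HeB).
  destruct (coefficients_exist beta gs) as (z & s & Hs & Hz).
  assert (Hbd := coefficients_bounded beta eps Gam gs z s He HeB
    (fun n => wsum_PSeries_le gs eps eps0 n ltac:(lra) Hcv0) Hs Hz). fold B in Hbd.
  destruct (wsum_bounded_ex_series eps 1 (Qseq z) ltac:(lra) (fun n => proj1 (Hbd n))) as [HexQ _].
  destruct (wsum_bounded_ex_series eps 1 s ltac:(lra) (fun n => proj1 (proj2 (Hbd n)))) as [Hexs Hsb].
  destruct (wsum_bounded_ex_series eps B z ltac:(lra) (fun n => proj2 (proj2 (Hbd n)))) as [Hexz Hzb].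
  (* The coefficients of 1 - w sigma(w), the future square root G. *)
  set (gam := fun n => match n with O => 1 | S m => - s m end).
  assert (Hgam : ex_series (fun n => Rabs (gam n) * eps ^ n)).
  { apply (wsum_bounded_ex_series eps 2 gam ltac:(lra)). intros [|n].
    - unfold wsum. simpl. rewrite Rabs_R1. lra.
    - unfold wsum. rewrite decomp_sum by lia. simpl pred.
      rewrite (sum_eq _ (fun i => (Rabs (s i) * eps ^ i) * eps)) by
        (intros i _; simpl; rewrite Rabs_Ropp; ring).
      rewrite <- scal_sum. change (sum_f_R0 _ n) with (wsum eps s n).
      simpl. rewrite Rabs_R1. destruct (Hbd n) as (_ & H & _).
      assert (eps * wsum eps s n <= eps * 1) by (apply Rmult_le_compat_l; lra). lra. }
  exists eps, (fun w => 1 / 3 + w * PSeries z w), (PSeries gam).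
  split; [lra|]. split; [apply PSeries_analytic_on, Hgam|].
  assert (HG : forall w, Rabs w < eps -> PSeries gam w = 1 - w * PSeries s w).
  { intros w Hw. rewrite (PSeries_cons gam 1 w (PS_opp s)).
    - rewrite PSeries_opp. ring.
    - intros [|n]; reflexivity.
    - rewrite CV_radius_opp. apply (CV_radius_gt_of_abs eps); assumption. }
  split; [ring|]. split; [rewrite HG; [ring|rewrite Rabs_R0; lra]|].
  intros w Hw. rewrite (HG w Hw).
  assert (Hzw : Rbar_lt (Rabs w) (CV_radius z)) by (apply (CV_radius_gt_of_abs eps); assumption).
  assert (Hsw : Rbar_lt (Rabs w) (CV_radius s)) by (apply (CV_radius_gt_of_abs eps); assumption).
  assert (HQw : Rbar_lt (Rabs w) (CV_radius (Qseq z))) by (apply (CV_radius_gt_of_abs eps); assumption).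
  assert (Hgw : Rbar_lt (Rabs w) (CV_radius gs)).
  { apply Rbar_lt_trans with (Rabs eps0); [simpl; lra|exact Hcv0]. }
  assert (Hgval : g w = PSeries gs w).
  { rewrite (proj2 (Hgs w ltac:(rewrite Rminus_0_r; unfold eps0 in *; lra))), Rminus_0_r. reflexivity. }
  assert (Hzzw := ex_pseries_mult z z w Hzw Hzw).
  assert (Hssw := ex_pseries_mult s s w Hsw Hsw).
  set (Z := PSeries z w). set (sg := PSeries s w).
  assert (Hle : Rabs w <= eps) by lra.
  specialize (Hsb w Hle). specialize (Hzb w Hle). fold Z in Hzb. fold sg in Hsb.
  assert (HQ : PSeries (Qseq z) w = (1 / 3 + w * Z) ^ 2).
  { assert (Hd : forall n, PS_decr_1 (Qseq z) n
               = PS_plus (PS_scal (2 / 3) z) (PS_incr_1 (PS_mult z z)) n) by reflexivity.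
    rewrite PSeries_decr_1 by (apply CV_radius_inside, HQw).
    rewrite (PSeries_ext _ _ w Hd), PSeries_plus, PSeries_scal, PSeries_incr_1, PSeries_mult
      by (assumption || (apply ex_pseries_scal; [apply Rmult_comm|apply CV_radius_inside, Hzw])
          || apply ex_pseries_incr_1, Hzzw).
    simpl Qseq. fold Z. field. }
  assert (Hsig : 2 * sg = (1 / 3 + w * Z) ^ 2 + w * sg ^ 2).
  { assert (Hd : forall n, PS_scal 2 s n = PS_plus (Qseq z) (PS_incr_1 (PS_mult s s)) n).
    { intros n. unfold PS_scal, PS_plus. rewrite (Hs n). unfold sig_step.
      change (2 * ((Qseq z n + PS_incr_1 (PS_mult s s) n) / 2)
              = Qseq z n + PS_incr_1 (PS_mult s s) n). field. }
    pose proof (PSeries_ext _ _ w Hd) as HH.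
    rewrite PSeries_plus, PSeries_scal, PSeries_incr_1, PSeries_mult, HQ in HH
      by (assumption || apply CV_radius_inside, HQw || apply ex_pseries_incr_1, Hssw).
    fold sg in HH. rewrite HH. ring. }
  set (Zp := PSeries (PS_derive z) w).
  assert (Hzeta : 4 * (w * Zp) + 5 * Z
    = 3 * (- (w * Z ^ 2) + (1 / 3 + w * Z) ^ 2 * sg - beta * (g w * (1 / 3 + w * Z) ^ 2))).
  { assert (Hd : forall n,
      PS_plus (PS_scal 4 (PS_incr_1 (PS_derive z))) (PS_scal 5 z) n =
      PS_scal 3 (PS_plus (PS_plus (PS_opp (PS_incr_1 (PS_mult z z))) (PS_mult (Qseq z) s))
                  (PS_opp (PS_scal beta (PS_mult gs (Qseq z))))) n).
    { intros n. unfold PS_scal, PS_plus, PS_opp.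
      (* The series w zeta'(w) has coefficients n z(n), so the left-hand side is (4 n + 5) z(n) and
         cancels the divisor in the recursion. *)
      assert (Hn : PS_incr_1 (PS_derive z) n = INR n * z n).
      { destruct n as [|n]; [|reflexivity]. simpl INR. rewrite Rmult_0_l. reflexivity. }
      rewrite Hn. rewrite (Hz n).
      change (4 * (INR n * (3 / (4 * INR n + 5) * (- PS_incr_1 (PS_mult z z) n
                + PS_mult (Qseq z) s n - beta * PS_mult gs (Qseq z) n)))
              + 5 * (3 / (4 * INR n + 5) * (- PS_incr_1 (PS_mult z z) n
                + PS_mult (Qseq z) s n - beta * PS_mult gs (Qseq z) n))
              = 3 * ((- PS_incr_1 (PS_mult z z) n + PS_mult (Qseq z) s n)
                + - (beta * PS_mult gs (Qseq z) n))).
      pose proof (pos_INR n). field. lra. }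
    pose proof (PSeries_ext _ _ w Hd) as HH.
    assert (E1 : ex_pseries (PS_derive z) w) by (apply ex_pseries_derive, Hzw).
    assert (E2 := ex_pseries_mult (Qseq z) s w HQw Hsw).
    assert (E3 := ex_pseries_mult gs (Qseq z) w Hgw HQw).
    assert (Ez : ex_pseries z w) by (apply CV_radius_inside, Hzw).
    assert (Hsc : forall (c : R) (a : nat -> R), ex_pseries a w -> ex_pseries (PS_scal c a) w)
      by (intros c a Ha; apply ex_pseries_scal; [apply Rmult_comm|exact Ha]).
    assert (F1 : ex_pseries (PS_opp (PS_incr_1 (PS_mult z z))) w)
      by (apply ex_pseries_opp, ex_pseries_incr_1, Hzzw).
    assert (F2 : ex_pseries (PS_opp (PS_scal beta (PS_mult gs (Qseq z)))) w)
      by (apply ex_pseries_opp, Hsc, E3).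
    assert (F3 : ex_pseries (PS_plus (PS_opp (PS_incr_1 (PS_mult z z))) (PS_mult (Qseq z) s)) w)
      by (apply ex_pseries_plus; assumption).
    rewrite PSeries_plus in HH by (apply Hsc; (assumption || (apply ex_pseries_incr_1; assumption))).
    rewrite !PSeries_scal, PSeries_incr_1 in HH.
    rewrite PSeries_plus in HH by assumption.
    rewrite PSeries_plus in HH by assumption.
    rewrite !PSeries_opp, PSeries_scal, PSeries_incr_1, !PSeries_mult, HQ, <- Hgval in HH by assumption.
    fold Z Zp sg in HH. rewrite HH. ring. }
  (* This and the next bound give the positivity claims: h = 1/3 + w Z >= 1/12 and G = 1 - w sg >=
     3/4. *)
  assert (HwZ : Rabs (w * Z) <= 1 / 4).
  { rewrite Rabs_mult. pose proof (Rabs_pos w). pose proof (Rabs_pos Z).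
    apply Rle_trans with (eps * B); [apply Rmult_le_compat; lra|exact HeB]. }
  assert (Hwsg : Rabs (w * sg) <= 1 / 4).
  { rewrite Rabs_mult. pose proof (Rabs_pos w). pose proof (Rabs_pos sg).
    apply Rle_trans with (eps * 1); [apply Rmult_le_compat; lra|lra]. }
  apply Rabs_le_between in HwZ. apply Rabs_le_between in Hwsg.
  cbv beta. fold Z sg. split; [lra|]. split; [lra|].
  (* After multiplication by w, [Hsig] becomes (1 - w sg)^2 = 1 - h^2 w and [Hzeta] becomes the
     profile equation, up to linear rearrangement of monomials. *)
  apply (f_equal (Rmult w)) in Hsig. apply (f_equal (Rmult w)) in Hzeta.
  split; [lra|].
  exists (Z + w * Zp). split.
  - evar_last.
    + apply (is_derive_plus (fun _ => 1 / 3) (fun w => w * PSeries z w)).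
      * apply is_derive_const.
      * apply (is_derive_mult (fun w => w) (PSeries z)).
        -- apply is_derive_id.
        -- apply is_derive_PSeries, Hzw.
        -- intros; apply Rmult_comm.
    + unfold plus, zero, one; simpl; unfold mult; simpl. fold Z Zp. ring.
  - cbv beta. fold Z sg. lra.
Qed.

(** * Profiles and the unstable manifold *)

Lemma lim_right0_filterlim (f : R -> R) (L : R) :
  lim_right0 f L <-> filterlim f (at_right 0) (locally L).
Proof.
  split.
  - intros H. apply filterlim_locally. intros eps.
    destruct (H eps (cond_pos eps)) as (del & Hdel & Hs).
    exists (mkposreal del Hdel). intros y Hy Hy0.
    change (Rabs (y - 0) < del) in Hy. change (Rabs (f y - L) < eps).
    apply Hs. rewrite Rminus_0_r, Rabs_pos_eq in Hy; lra.
  - intros H eps Heps.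
    assert (HL := proj1 (filterlim_locally f L) H (mkposreal eps Heps)).
    destruct HL as [del Hd]. exists del. split; [apply cond_pos|].
    intros s Hs. apply (Hd s); [|apply Hs].
    change (Rabs (s - 0) < del). rewrite Rminus_0_r, Rabs_pos_eq; lra.
Qed.

Lemma lim_right0_comp (f F : R -> R) (L : R) :
  lim_right0 f L -> continuous F L -> lim_right0 (fun s => F (f s)) (F L).
Proof.
  rewrite !lim_right0_filterlim. intros Hf HF.
  exact (filterlim_comp _ _ _ f F _ _ _ Hf HF).
Qed.

Lemma lim_right0_plus (f1 f2 : R -> R) (L1 L2 : R) :
  lim_right0 f1 L1 -> lim_right0 f2 L2 -> lim_right0 (fun s => f1 s + f2 s) (L1 + L2).
Proof.
  rewrite !lim_right0_filterlim. intros H1 H2.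
  eapply filterlim_comp_2; [exact H1|exact H2|apply (filterlim_plus (V := R_NormedModule))].
Qed.

Lemma lim_right0_mult (f1 f2 : R -> R) (L1 L2 : R) :
  lim_right0 f1 L1 -> lim_right0 f2 L2 -> lim_right0 (fun s => f1 s * f2 s) (L1 * L2).
Proof.
  rewrite !lim_right0_filterlim. intros H1 H2.
  eapply filterlim_comp_2; [exact H1|exact H2|apply (filterlim_mult (K := R_AbsRing))].
Qed.

Lemma lim_right0_const (c : R) : lim_right0 (fun _ => c) c.
Proof.
  intros eps He. exists 1. split; [lra|]. intros. rewrite Rminus_diag, Rabs_R0. exact He.
Qed.

Lemma lim_right0_id : lim_right0 (fun s => s) 0.
Proof.
  intros eps He. exists eps. split; [exact He|]. intros s Hs.
  rewrite Rminus_0_r, Rabs_pos_eq; lra.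
Qed.

Lemma lim_right0_ext (f1 f2 : R -> R) (L d : R) :
  0 < d -> (forall s, 0 < s < d -> f1 s = f2 s) -> lim_right0 f1 L -> lim_right0 f2 L.
Proof.
  intros Hd H H1 eps He. destruct (H1 eps He) as (del & Hdel & Hs).
  exists (Rmin d del). split; [apply Rmin_glb_lt; assumption|].
  intros s Hs'. pose proof (Rmin_l d del). pose proof (Rmin_r d del).
  rewrite <- H by lra. apply Hs. lra.
Qed.

Lemma lim_right0_unique (f : R -> R) (L1 L2 : R) :
  lim_right0 f L1 -> lim_right0 f L2 -> L1 = L2.
Proof.
  rewrite !lim_right0_filterlim. intros H1 H2.
  exact (filterlim_locally_unique f L1 L2 H1 H2).
Qed.

Lemma derive_nonpos_le (f df : R -> R) (a b : R) :
  a <= b -> (forall x, a <= x <= b -> is_derive f x (df x)) ->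
  (forall x, a <= x <= b -> df x <= 0) -> f b <= f a.
Proof.
  intros Hab Hd Hn. destruct Hab as [Hab|Hab]; [|subst; lra].
  destruct (MVT_cor2 f df a b Hab) as (c & Hc & Hc').
  - intros x Hx. apply is_derive_Reals, Hd, Hx.
  - specialize (Hn c ltac:(lra)). nra.
Qed.

(** Nothing is asked at w = 0, where the equation degenerates; the value there enters separately, as
    a right limit. *)
Definition profile (beta : R) (g : R -> R) (W : R) (h : R -> R) : Prop :=
  0 < W /\
  (forall w, 0 < w < W -> 0 < h w /\ h w ^ 2 * w < 1 /\
     is_derive h w (etaF beta g (h w) w / (2 * w))).

(* At eta = 1/3, w = 0 the derivative of etaF in eta is -1/2; this is the
   quantitative form that makes the unstable manifold unique. *)
Lemma etaF_monotone (beta : R) (g : R -> R) (a b w : R) :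
  Rabs (a - 1 / 3) < 3 / 100 -> Rabs (b - 1 / 3) < 3 / 100 -> 0 < w < 1 / 100 ->
  Rabs (beta * w * g w) < 1 / 100 ->
  (a - b) * (etaF beta g a w - etaF beta g b w) <= 0.
Proof.
  intros Ha Hb Hw Hg. apply Rabs_def2 in Ha, Hb, Hg.
  unfold etaF. set (k := beta * w * g w) in *.
  assert (Ha2 : 0 < 1 - a ^ 2 * w) by nra. assert (Hb2 : 0 < 1 - b ^ 2 * w) by nra.
  pose proof (sqrt_sqrt _ (Rlt_le _ _ Ha2)) as Hra.
  pose proof (sqrt_sqrt _ (Rlt_le _ _ Hb2)) as Hrb.
  set (ra := sqrt (1 - a ^ 2 * w)) in *. set (rb := sqrt (1 - b ^ 2 * w)) in *.
  assert (Hra0 : 0 <= ra) by apply sqrt_pos. assert (Hrb0 : 0 <= rb) by apply sqrt_pos.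
  assert (Haw : 0 <= a ^ 2 * w <= 1 / 400) by nra.
  assert (Hbw : 0 <= b ^ 2 * w <= 1 / 400) by nra.
  assert (Hra1 : 99 / 100 <= ra) by nra.
  assert (Hrb1 : 99 / 100 <= rb) by nra.
  assert (Hdiff : ra - rb = - ((a - b) * (a + b) * w / (ra + rb))).
  { apply (Rmult_eq_reg_r (ra + rb)); [|lra]. field_simplify; [|lra]. nra. }
  (* The divided difference of [etaF] between a and b. Near (1/3, 0) it is close to 1/2 - (3/2)(2/3)
     = -1/2. *)
  set (A := 1 / 2 - 3 / 2 * (a + b) * (ra + k) + 3 / 2 * b ^ 2 * ((a + b) * w / (ra + rb))).
  assert (HA : A <= 0).
  { assert (Hq : 0 <= (a + b) * w / (ra + rb) <= 1 / 100).
    { split; [apply Rle_div_r; nra|apply Rle_div_l; nra]. }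
    assert (H1 : 3 / 2 * b ^ 2 * ((a + b) * w / (ra + rb)) <= 1 / 100) by nra.
    assert (H2 : 6 / 10 * (98 / 100) <= (a + b) * (ra + k)) by nra.
    unfold A. lra. }
  replace ((a - b) * _) with ((a - b) ^ 2 * A).
  - pose proof (pow2_ge_0 (a - b)). nra.
  - assert (E : a / 2 * (1 - 3 * a * ra) - 3 / 2 * beta * a ^ 2 * w * g w
       - (b / 2 * (1 - 3 * b * rb) - 3 / 2 * beta * b ^ 2 * w * g w)
       = 1 / 2 * (a - b) - 3 / 2 * ((a - b) * (a + b)) * (ra + k) - 3 / 2 * b ^ 2 * (ra - rb))
      by (unfold k; field).
    rewrite E, Hdiff. unfold A. field. lra.
Qed.

Lemma analytic_on_continuous (g : R -> R) (x : R) :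
  analytic_on (fun _ => True) g -> continuous g x.
Proof.
  intros H. apply (ex_derive_continuous g), (analytic_on_ex_derive _ g x H I).
Qed.

Lemma lim_right0_weight (beta : R) (g : R -> R) :
  analytic_on (fun _ => True) g -> lim_right0 (fun w => beta * w * g w) 0.
Proof.
  intros Hg. replace 0 with (beta * 0 * g 0) by ring.
  apply lim_right0_mult; [apply lim_right0_mult; [apply lim_right0_const|apply lim_right0_id]|].
  apply (lim_right0_comp (fun s => s) g); [apply lim_right0_id|].
  apply analytic_on_continuous, Hg.
Qed.

(** By [etaF_monotone], (h1 - h2)^2 does not increase with w near 0, yet it tends to 0 as w tends to
    0 from the right; hence it vanishes. *)
Lemma profile_unique (beta : R) (g : R -> R) (W1 W2 : R) (h1 h2 : R -> R) :
  analytic_on (fun _ => True) g ->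
  profile beta g W1 h1 -> lim_right0 h1 (1 / 3) ->
  profile beta g W2 h2 -> lim_right0 h2 (1 / 3) ->
  exists W, 0 < W /\ forall w, 0 < w < W -> h1 w = h2 w.
Proof.
  intros Hg (HW1 & H1) L1 (HW2 & H2) L2.
  destruct (L1 (3 / 100) ltac:(lra)) as (d1 & Hd1 & B1).
  destruct (L2 (3 / 100) ltac:(lra)) as (d2 & Hd2 & B2).
  destruct (lim_right0_weight beta g Hg (1 / 100) ltac:(lra)) as (d3 & Hd3 & B3).
  set (W := Rmin (Rmin W1 W2) (Rmin (Rmin d1 d2) (Rmin d3 (1 / 100)))).
  assert (HW : 0 < W) by (unfold W; repeat apply Rmin_glb_lt; lra).
  assert (HWl : W <= W1 /\ W <= W2 /\ W <= d1 /\ W <= d2 /\ W <= d3 /\ W <= 1 / 100).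
  { unfold W. pose proof (Rmin_l (Rmin W1 W2) (Rmin (Rmin d1 d2) (Rmin d3 (1 / 100)))).
    pose proof (Rmin_r (Rmin W1 W2) (Rmin (Rmin d1 d2) (Rmin d3 (1 / 100)))).
    pose proof (Rmin_l W1 W2). pose proof (Rmin_r W1 W2).
    pose proof (Rmin_l (Rmin d1 d2) (Rmin d3 (1 / 100))).
    pose proof (Rmin_r (Rmin d1 d2) (Rmin d3 (1 / 100))).
    pose proof (Rmin_l d1 d2). pose proof (Rmin_r d1 d2).
    pose proof (Rmin_l d3 (1/100)). pose proof (Rmin_r d3 (1/100)). lra. }
  exists W. split; [exact HW|]. intros w Hw.
  assert (Hmon : forall u, 0 < u <= w -> (h1 w - h2 w) ^ 2 <= (h1 u - h2 u) ^ 2).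
  { intros u Hu.
    apply (derive_nonpos_le (fun v => (h1 v - h2 v) ^ 2)
      (fun v => (h1 v - h2 v) * (etaF beta g (h1 v) v - etaF beta g (h2 v) v) / v) u w).
    - lra.
    - intros v Hv. destruct (H1 v ltac:(lra)) as (_ & _ & D1).
      destruct (H2 v ltac:(lra)) as (_ & _ & D2).
      evar_last.
      + apply (is_derive_pow (fun v => h1 v - h2 v) 2).
        apply (is_derive_minus h1 h2); [exact D1|exact D2].
      + unfold minus, plus, opp; simpl. field. lra.
    - intros v Hv. apply Rle_div_l; [lra|]. rewrite Rmult_0_l.
      apply etaF_monotone; [apply B1|apply B2| |]; try lra.
      rewrite <- (Rminus_0_r (beta * v * g v)). apply B3. lra. }
  assert (Hlim : lim_right0 (fun u => (h1 u + -1 * h2 u) ^ 2) ((1 / 3 + -1 * (1 / 3)) ^ 2)).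
  { apply (lim_right0_comp (fun u => h1 u + -1 * h2 u) (fun x => x ^ 2)).
    - apply lim_right0_plus; [exact L1|apply lim_right0_mult; [apply lim_right0_const|exact L2]].
    - apply (ex_derive_continuous (fun x : R => x ^ 2)). auto_derive. trivial. }
  apply NNPP. intros Hne.
  assert (Hp : 0 < (h1 w - h2 w) ^ 2).
  { apply pow2_gt_0. lra. }
  destruct (Hlim _ Hp) as (d & Hd & Hs).
  set (u := Rmin (d / 2) w).
  assert (Hu : 0 < u /\ u <= w /\ u <= d / 2).
  { unfold u. split; [apply Rmin_glb_lt; lra|]. split; [apply Rmin_r|apply Rmin_l]. }
  specialize (Hs u ltac:(lra)). specialize (Hmon u ltac:(lra)).
  replace ((1 / 3 + -1 * (1 / 3)) ^ 2) with 0 in Hs by field.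
  rewrite Rminus_0_r in Hs. apply Rabs_def2 in Hs. nra.
Qed.

Lemma etaF_lim (beta : R) (g h : R -> R) (eta0 : R) :
  analytic_on (fun _ => True) g -> lim_right0 h eta0 ->
  lim_right0 (fun w => etaF beta g (h w) w) (eta0 / 2 * (1 - 3 * eta0)).
Proof.
  intros Hg L.
  (* Differences are written with a factor -1, so that the limit rules for sums and products
     suffice. *)
  assert (Lr : lim_right0 (fun w => sqrt (1 + -1 * (h w * h w * w))) (sqrt (1 + -1 * (eta0 * eta0 * 0)))).
  { apply (lim_right0_comp (fun w => 1 + -1 * (h w * h w * w)) sqrt); [|apply continuous_sqrt].
    repeat first [apply lim_right0_plus | apply lim_right0_mult | apply lim_right0_const
                 | exact L | apply lim_right0_id]. }
  replace (sqrt (1 + -1 * (eta0 * eta0 * 0))) with 1 in Lr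
    by (replace (1 + -1 * (eta0 * eta0 * 0)) with 1 by ring; rewrite sqrt_1; reflexivity).
  replace (eta0 / 2 * (1 - 3 * eta0))
    with (1 / 2 * eta0 + (-3 / 2 * (eta0 * eta0) * 1 + -3 / 2 * (eta0 * eta0) * 0)) by field.
  apply (lim_right0_ext (fun w => 1 / 2 * h w + (-3 / 2 * (h w * h w) * sqrt (1 + -1 * (h w * h w * w))
    + -3 / 2 * (h w * h w) * (beta * w * g w))) _ _ 1); [lra| |].
  - intros w _. unfold etaF. replace (1 - h w ^ 2 * w) with (1 + -1 * (h w * h w * w)) by ring. field.
  - repeat first [apply lim_right0_plus | exact Lr | apply (lim_right0_weight beta g Hg)
      | apply lim_right0_mult | apply lim_right0_const | exact L ].
Qed.

(* If the limit were not 1/3 then w h'(w) would stay away from 0 and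
   h (2 w) - h w could not tend to 0. *)
Lemma profile_limit (beta : R) (g : R -> R) (W eta0 : R) (h : R -> R) :
  analytic_on (fun _ => True) g -> profile beta g W h -> 0 < eta0 -> lim_right0 h eta0 ->
  eta0 = 1 / 3.
Proof.
  intros Hg (HW & H) He L. apply NNPP. intros Hne.
  set (k := eta0 / 2 * (1 - 3 * eta0)).
  assert (Hk : 0 < Rabs k).
  { apply Rabs_pos_lt. unfold k. apply Rmult_integral_contrapositive. split; lra. }
  destruct (etaF_lim beta g h eta0 Hg L (Rabs k / 2) ltac:(lra)) as (d1 & Hd1 & B1).
  (* The mean value theorem on [w, 2 w] will give an increment larger than (|k|/2)(1/4) = |k|/8,
     while two tolerances of |k|/16 allow less than that. *)
  destruct (L (Rabs k / 16) ltac:(lra)) as (d2 & Hd2 & B2).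
  set (w := Rmin (W / 3) (Rmin (d1 / 3) (d2 / 3))).
  assert (Hw : 0 < w /\ w <= W / 3 /\ w <= d1 / 3 /\ w <= d2 / 3).
  { unfold w. pose proof (Rmin_l (W / 3) (Rmin (d1 / 3) (d2 / 3))).
    pose proof (Rmin_r (W / 3) (Rmin (d1 / 3) (d2 / 3))).
    pose proof (Rmin_l (d1 / 3) (d2 / 3)). pose proof (Rmin_r (d1 / 3) (d2 / 3)).
    repeat split; try lra. repeat apply Rmin_glb_lt; lra. }
  destruct (MVT_cor2 h (fun v => etaF beta g (h v) v / (2 * v)) w (2 * w) ltac:(lra))
    as (c & Hc & Hc').
  { intros v Hv. apply is_derive_Reals. apply H. lra. }
  specialize (B1 c ltac:(lra)). fold k in B1.
  assert (Hw1 := B2 w ltac:(lra)). assert (Hw2 := B2 (2 * w) ltac:(lra)).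
  set (F := etaF beta g (h c) c) in *.
  assert (HF : Rabs k / 2 < Rabs F).
  { pose proof (Rabs_triang_inv k F). rewrite (Rabs_minus_sym k F) in H0. lra. }
  assert (Hd : Rabs (h (2 * w) - h w) < Rabs k / 8).
  { replace (h (2 * w) - h w) with ((h (2 * w) - eta0) + - (h w - eta0)) by ring.
    eapply Rle_lt_trans; [apply Rabs_triang|]. rewrite Rabs_Ropp. lra. }
  rewrite Hc in Hd. replace (F / (2 * c) * (2 * w - w)) with (F * (w / (2 * c))) in Hd
    by (field; lra).
  rewrite Rabs_mult, (Rabs_pos_eq (w / (2 * c))) in Hd
    by (apply Rlt_le, Rdiv_lt_0_compat; lra).
  assert (1 / 4 <= w / (2 * c)) by (apply (Rle_div_r (1 / 4) w (2 * c)); lra).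
  nra.
Qed.

(** The component w(t) = q exp(2 t) is explicit, so w can replace time along the orbit, and t -> -oo
    becomes w -> 0. The orbit lives until some T > 0, which puts W = q exp(2 T) strictly beyond
    q. *)
Lemma Wu_profile (beta : R) (g : R -> R) (p q : R) :
  Wu beta g p q -> 0 < q ->
  exists (W : R) (h : R -> R), q < W /\ profile beta g W h /\ lim_right0 h (1 / 3) /\ h q = p.
Proof.
  intros (HN & T & eta & w & HT & He0 & Hw0 & Hode & Hlim) Hq.
  assert (Hwt : forall t, t < T -> w t = q * exp (2 * t)).
  { intros t Ht.
    assert (Hconst : forall a b, a <= b -> b < T ->
              w b * exp (- (2 * b)) = w a * exp (- (2 * a))).
    { intros a b Hab Hb.
      assert (Hder : forall x, a <= x <= b -> is_derive (fun x => w x * exp (- (2 * x))) x 0).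
      { intros x Hx. destruct (Hode x ltac:(lra)) as (_ & _ & Hd).
        apply is_derive_Reals in Hd. evar_last.
        - apply (is_derive_mult w (fun x => exp (- (2 * x)))); [exact Hd| |intros; apply Rmult_comm].
          auto_derive; [trivial|reflexivity].
        - unfold plus; simpl; unfold mult; simpl. ring. }
      apply Rle_antisym.
      - apply (derive_nonpos_le (fun x => w x * exp (- (2 * x))) (fun _ => 0)); [exact Hab|exact Hder|intros; lra].
      - apply Ropp_le_cancel.
        apply (derive_nonpos_le (fun x => - (w x * exp (- (2 * x)))) (fun _ => 0)); [exact Hab| |intros; lra].
        intros x Hx. evar_last; [apply (is_derive_opp (fun x => w x * exp (- (2 * x)))), Hder, Hx|].
        unfold opp; simpl. ring. }
    assert (E : w t * exp (- (2 * t)) = q).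
    { rewrite <- Hw0. destruct (Rle_dec t 0) as [Ht0|Ht0].
      - rewrite <- (Hconst t 0) by lra. rewrite Rmult_0_r, Ropp_0, exp_0. ring.
      - rewrite (Hconst 0 t) by lra. rewrite Rmult_0_r, Ropp_0, exp_0. ring. }
    rewrite <- E, Rmult_assoc, <- exp_plus.
    replace (- (2 * t) + 2 * t) with 0 by ring. rewrite exp_0. ring. }
  set (tt := fun v => / 2 * ln (v / q)).
  assert (Hlt : forall v T', 0 < v -> v < q * exp (2 * T') -> tt v < T').
  { intros v T' Hv Hv'. unfold tt.
    assert (ln (v / q) < 2 * T'); [|lra].
    rewrite <- (ln_exp (2 * T')). apply ln_increasing; [apply Rdiv_lt_0_compat; assumption|].
    apply Rlt_div_l; [exact Hq|]. lra. }
  assert (Hwv : forall v, 0 < v -> q * exp (2 * tt v) = v).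
  { intros v Hv. unfold tt. replace (2 * (/ 2 * ln (v / q))) with (ln (v / q)) by field.
    rewrite exp_ln by (apply Rdiv_lt_0_compat; assumption). field. lra. }
  exists (q * exp (2 * T)), (fun v => eta (tt v)).
  assert (HW : q < q * exp (2 * T)).
  { rewrite <- (Rmult_1_r q) at 1. apply Rmult_lt_compat_l; [exact Hq|].
    rewrite <- exp_0. apply exp_increasing. lra. }
  split; [exact HW|]. split; [split; [lra|]|split].
  - intros v Hv. pose proof (Hlt v T ltac:(lra) ltac:(lra)) as Ht.
    destruct (Hode _ Ht) as ((HN1 & HN2) & Hd & _).
    rewrite (Hwt _ Ht), (Hwv v ltac:(lra)) in HN2, Hd.
    split; [exact HN1|]. split; [exact HN2|].
    apply is_derive_Reals in Hd. evar_last.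
    + apply (is_derive_comp eta tt); [exact Hd|]. unfold tt. auto_derive; [|reflexivity].
      apply Rdiv_lt_0_compat; lra.
    + unfold scal; simpl; unfold mult; simpl. field. split; lra.
  - intros eps Heps. destruct (Hlim eps Heps) as (t0 & Ht0).
    exists (q * exp (2 * t0)). split; [apply Rmult_lt_0_compat; [exact Hq|apply exp_pos]|].
    intros v Hv. apply Ht0. apply Hlt; lra.
  - unfold tt. rewrite Rdiv_diag by lra. rewrite ln_1, Rmult_0_r. exact He0.
Qed.

Lemma profile_Wu (beta : R) (g : R -> R) (W q : R) (h : R -> R) :
  profile beta g W h -> lim_right0 h (1 / 3) -> 0 < q < W -> Wu beta g (h q) q.
Proof.
  intros (HW & H) L Hq. split.
  - destruct (H q Hq) as (H1 & H2 & _). split; assumption.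
  - assert (Hlt : forall t V, 0 < V -> t < / 2 * ln (V / q) -> 0 < q * exp (2 * t) < V).
    { intros t V HV Ht. split; [apply Rmult_lt_0_compat; [lra|apply exp_pos]|].
      assert (E : exp (2 * t) < V / q).
      { rewrite <- (exp_ln (V / q)) by (apply Rdiv_lt_0_compat; lra).
        apply exp_increasing. lra. }
      apply Rlt_div_r in E; lra. }
    (* The orbit leaves the domain of h when q exp(2 t) = W. *)
    exists (/ 2 * ln (W / q)), (fun t => h (q * exp (2 * t))), (fun t => q * exp (2 * t)).
    split.
    { apply Rmult_lt_0_compat; [lra|]. rewrite <- ln_1. apply ln_increasing; [lra|].
      apply Rlt_div_r; lra. }
    split; [rewrite Rmult_0_r, exp_0, Rmult_1_r; reflexivity|].
    split; [rewrite Rmult_0_r, exp_0, Rmult_1_r; reflexivity|].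
    split.
    + intros t Ht. pose proof (Hlt t W HW Ht) as Hv. destruct (H _ Hv) as (H1 & H2 & Hd).
      split; [split; assumption|].
      assert (Hw : is_derive (fun t => q * exp (2 * t)) t (2 * (q * exp (2 * t)))).
      { auto_derive; [trivial|ring]. }
      split; apply is_derive_Reals; [|exact Hw].
      evar_last; [apply (is_derive_comp h (fun t => q * exp (2 * t))); [exact Hd|exact Hw]|].
      unfold scal; simpl; unfold mult; simpl. field. split; [apply Rgt_not_eq, exp_pos|lra].
    + intros eps Heps. destruct (L eps Heps) as (d & Hd & Hs).
      set (V := Rmin d eps).
      assert (HV : 0 < V) by (apply Rmin_glb_lt; assumption).
      exists (/ 2 * ln (V / q)). intros t Ht. pose proof (Hlt t V HV Ht) as Hv.
      pose proof (Rmin_l d eps). pose proof (Rmin_r d eps). fold V in H0, H1.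
      split; [apply Hs; lra|]. rewrite Rabs_pos_eq; lra.
Qed.

(** * Lifting profiles to solutions of the toy model *)

(** The first component of the inverse of Phi: eta = sqrt(1 - rho^2) / r solved for rho > 0, with
    eta = h(r^2). *)
Definition profile_rho (h : R -> R) (r : R) : R := sqrt (1 - h (r ^ 2) ^ 2 * r ^ 2).

(** Time is eliminated: along a trajectory drho/dr = rho'/r' = [toyF] / rho, and the chain rule
    turns the profile equation into this one. *)
Lemma profile_rho_ode (beta : R) (g h : R -> R) (W r : R) :
  profile beta g W h -> 0 < r -> r ^ 2 < W ->
  0 < profile_rho h r < 1 /\
  is_derive (profile_rho h) r (toyF beta g (profile_rho h r) r / profile_rho h r).
Proof.
  intros (HW & H) Hr Hr2.
  assert (Hrr : 0 < r ^ 2) by (apply pow_lt, Hr).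
  destruct (H (r ^ 2) ltac:(lra)) as (Hh & HN & Hd).
  assert (Hpos : 0 < 1 - h (r ^ 2) ^ 2 * r ^ 2) by lra.
  assert (Hlt : 0 < h (r ^ 2) ^ 2 * r ^ 2) by (apply Rmult_lt_0_compat; [apply pow_lt|]; assumption).
  assert (HP : 0 < profile_rho h r) by (apply sqrt_lt_R0, Hpos).
  assert (Hsq : profile_rho h r * profile_rho h r = 1 - h (r ^ 2) ^ 2 * r ^ 2)
    by (apply sqrt_sqrt; lra).
  split; [split; [exact HP|nra]|].
  assert (Heta : sqrt (1 - profile_rho h r ^ 2) = h (r ^ 2) * r).
  { replace (1 - profile_rho h r ^ 2) with (Rsqr (h (r ^ 2) * r)).
    - apply sqrt_Rsqr. apply Rlt_le, Rmult_lt_0_compat; assumption.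
    - unfold Rsqr. replace (profile_rho h r ^ 2) with (profile_rho h r * profile_rho h r) by ring.
      rewrite Hsq. ring. }
  unfold toyF. rewrite Heta.
  assert (HF : etaF beta g (h (r ^ 2)) (r ^ 2)
    = h (r ^ 2) / 2 * (1 - 3 * h (r ^ 2) * profile_rho h r)
      - 3 / 2 * beta * h (r ^ 2) ^ 2 * r ^ 2 * g (r ^ 2)) by reflexivity.
  replace (profile_rho h r ^ 2) with (1 - h (r ^ 2) ^ 2 * r ^ 2) by (rewrite <- Hsq; ring).
  rewrite HF in Hd.
  unfold profile_rho at 1.
  evar_last.
  - apply (is_derive_sqrt (fun r => 1 - h (r ^ 2) ^ 2 * r ^ 2)); [|exact Hpos].
    apply (is_derive_minus (fun _ => 1) (fun r => h (r ^ 2) ^ 2 * r ^ 2));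
      [apply is_derive_const|].
    apply (is_derive_mult (fun r => h (r ^ 2) ^ 2) (fun r => r ^ 2));
      [|apply (is_derive_pow (fun r => r) 2), is_derive_id|intros; apply Rmult_comm].
    apply (is_derive_pow (fun r => h (r ^ 2)) 2).
    apply (is_derive_comp h (fun r => r ^ 2)); [exact Hd|].
    apply (is_derive_pow (fun r => r) 2), is_derive_id.
  - change (sqrt (1 - h (r ^ 2) ^ 2 * r ^ 2)) with (profile_rho h r).
    unfold scal, minus, plus, opp, zero, one; simpl; unfold mult; simpl.
    set (X := h (r * (r * 1))) in *. set (P := profile_rho h r) in *. field. split; lra.
Qed.

(** Separation of variables: S is the primitive of 1/P that vanishes at a, and rr is its inverse.
    Since P <= 1, S expands distances; hence S is injective, rr is 1-Lipschitz and rr s - a <= s.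
    The margins A < a and b < B make S differentiable at the ends as well. *)
Lemma autonomous_lift (P : R -> R) (A B a b : R) :
  A < a < b -> b < B ->
  (forall x, A < x < B -> 0 < P x <= 1 /\ continuous P x) ->
  exists S rr : R -> R,
    S a = 0 /\ 0 < S b /\
    (forall u, a < u < b -> 0 < S u < S b /\ rr (S u) = u) /\
    (forall s, 0 < s < S b -> a < rr s < b /\ S (rr s) = s /\
       is_derive rr s (P (rr s)) /\ rr s - a <= s).
Proof.
  intros HA HB HP.
  set (S := (fun u => RInt (fun x => / P x) a u) : R -> R).
  assert (Hc : forall x, A < x < B -> continuous (fun x => / P x) x).
  { intros x Hx. destruct (HP x Hx) as [Hp Hpc].
    apply (continuous_comp P Rinv); [exact Hpc|].
    apply (ex_derive_continuous Rinv). auto_derive. lra. }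
  assert (HS : forall u, A < u < B -> is_derive S u (/ P u)).
  { intros u Hu. apply (is_derive_RInt (fun x => / P x) S a u); [|apply Hc, Hu].
    assert (Hd : 0 < Rmin (u - A) (B - u)) by (apply Rmin_glb_lt; lra).
    exists (mkposreal _ Hd). intros y Hy. change (Rabs (y - u) < Rmin (u - A) (B - u)) in Hy.
    pose proof (Rmin_l (u - A) (B - u)). pose proof (Rmin_r (u - A) (B - u)).
    apply Rabs_def2 in Hy. apply (RInt_correct (V := R_CompleteNormedModule)).
    apply ex_RInt_continuous. intros z Hz. apply Hc.
    pose proof (Rmin_glb_lt a y A). pose proof (Rmax_lub_lt a y B). lra. }
  assert (Hexp : forall u v, A < u -> u <= v -> v < B -> v - u <= S v - S u).
  { intros u v Hu Huv Hv. destruct Huv as [Huv|Huv]; [|subst; lra].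
    destruct (MVT_cor2 S (fun x => / P x) u v Huv) as (c & Hc1 & Hc2).
    - intros x Hx. apply is_derive_Reals, HS. lra.
    - destruct (HP c ltac:(lra)) as [Hpc _].
      assert (1 <= / P c) by (rewrite <- Rinv_1; apply Rinv_le_contravar; lra).
      rewrite Hc1. nra. }
  assert (HSa : S a = 0) by exact (RInt_point a (fun x => / P x)).
  assert (HSb : 0 < S b) by (pose proof (Hexp a b ltac:(lra) ltac:(lra) ltac:(lra)); lra).
  (* A sigma type makes rr a function of s; outside (0, S b) it takes the dummy value a. *)
  assert (Hinv : forall s, {u : R | 0 < s < S b -> a < u < b /\ S u = s}).
  { intros s. destruct (Rlt_dec 0 s) as [H1|H1]; [|exists a; lra].
    destruct (Rlt_dec s (S b)) as [H2|H2]; [|exists a; lra].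
    destruct (Ranalysis5.IVT_interv (fun u => S u - s) a b) as (u & Hu & Hu0).
    - intros x Hx. apply continuity_pt_filterlim.
      apply (ex_derive_continuous (fun u => S u - s)).
      eexists. apply (is_derive_minus S (fun _ => s)); [apply HS; lra|apply is_derive_const].
    - lra.
    - lra.
    - lra.
    - exists u. intros _. split; [|lra].
      destruct (Req_dec u a); [subst; lra|]. destruct (Req_dec u b); [subst; lra|]. lra. }
  set (rr := fun s => proj1_sig (Hinv s)).
  assert (Hrr : forall s, 0 < s < S b -> a < rr s < b /\ S (rr s) = s)
    by (intros s; exact (proj2_sig (Hinv s))).
  assert (HSin : forall u, a < u < b -> 0 < S u < S b).
  { intros u Hu. pose proof (Hexp a u ltac:(lra) ltac:(lra) ltac:(lra)).
    pose proof (Hexp u b ltac:(lra) ltac:(lra) ltac:(lra)). lra. }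
  exists S, rr. split; [exact HSa|]. split; [exact HSb|]. split.
  - intros u Hu. split; [apply HSin, Hu|].
    destruct (Hrr (S u) (HSin u Hu)) as [H1 H2].
    destruct (Rle_dec (rr (S u)) u) as [Hle|Hle].
    + pose proof (Hexp (rr (S u)) u ltac:(lra) Hle ltac:(lra)). lra.
    + pose proof (Hexp u (rr (S u)) ltac:(lra) ltac:(lra) ltac:(lra)). lra.
  - intros s Hs. destruct (Hrr s Hs) as [H1 H2]. split; [exact H1|]. split; [exact H2|].
    split; [|pose proof (Hexp a (rr s) ltac:(lra) ltac:(lra) ltac:(lra)); lra].
    set (u := rr s) in *.
    destruct (HP u ltac:(lra)) as [Hpu _].
    apply is_derive_Reals. intros eps Heps.
    assert (Hd := HS u ltac:(lra)). apply is_derive_Reals in Hd.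
    destruct (Hd eps Heps) as [d Hd'].
    assert (Hm : 0 < Rmin d (Rmin s (S b - s))).
    { apply Rmin_glb_lt; [apply cond_pos|]. apply Rmin_glb_lt; lra. }
    exists (mkposreal _ Hm). intros k Hk0 Hk. simpl in Hk.
    pose proof (Rmin_l d (Rmin s (S b - s))). pose proof (Rmin_r d (Rmin s (S b - s))).
    pose proof (Rmin_l s (S b - s)). pose proof (Rmin_r s (S b - s)).
    assert (Hkd : Rabs k < d) by lra.
    assert (Hks : Rabs k < Rmin s (S b - s)) by lra.
    apply Rabs_def2 in Hks.
    destruct (Hrr (s + k) ltac:(lra)) as [K3 K4].
    set (v := rr (s + k)) in *.
    (* Expansion of S makes v - u small along with k, so the derivative of S at u applies to the
       increment v - u. *)
    assert (Hvu : Rabs (v - u) <= Rabs k).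
    { destruct (Rle_dec u v) as [Hle|Hle].
      - pose proof (Hexp u v ltac:(lra) Hle ltac:(lra)).
        rewrite !Rabs_pos_eq; lra.
      - pose proof (Hexp v u ltac:(lra) ltac:(lra) ltac:(lra)).
        rewrite !Rabs_left; lra. }
    assert (Hvu0 : v - u <> 0).
    { intros E. assert (Ev : v = u) by lra. rewrite Ev in K4. lra. }
    specialize (Hd' (v - u) Hvu0 ltac:(lra)).
    replace (u + (v - u)) with v in Hd' by ring. rewrite K4, H2 in Hd'.
    change (rr s) with u.
    replace ((v - u) / k - P u)
      with (- (P u * ((v - u) / k) * ((s + k - s) / (v - u) - / P u))).
    2:{ field. repeat split; lra. }
    rewrite Rabs_Ropp, !Rabs_mult, (Rabs_pos_eq (P u)) by lra.
    assert (Hq : Rabs ((v - u) / k) <= 1).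
    { unfold Rdiv. rewrite Rabs_mult, Rabs_inv. apply Rle_div_l.
      - apply Rabs_pos_lt, Hk0.
      - lra. }
    pose proof (Rabs_pos ((v - u) / k)) as Hq0.
    pose proof (Rabs_pos ((s + k - s) / (v - u) - / P u)) as Hq1.
    assert (P u * Rabs ((v - u) / k) <= 1) by nra.
    nra.
Qed.

(** P is controlled on (A, B), the equation for P only on (a, b). This allows a = 0, a point that is
    singular for [toyF] but regular for r' = P(r). *)
Lemma toy_lift (beta : R) (g P : R -> R) (A B a b : R) :
  A < a < b -> b < B -> 0 <= a ->
  (forall x, A < x < B -> 0 < P x <= 1 /\ continuous P x) ->
  (forall x, a < x < b -> P x < 1 /\ is_derive P x (toyF beta g (P x) x / P x)) ->
  exists S rr : R -> R,
    0 < S b /\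
    (forall u, a < u < b -> 0 < S u < S b /\ rr (S u) = u) /\
    (forall s, 0 < s < S b -> a < rr s < b /\ rr s - a <= s) /\
    toy_sol beta g (in_oint (Some 0) (Some (S b))) (fun s => P (rr s)) rr.
Proof.
  intros HA HB Ha HP Hode.
  destruct (autonomous_lift P A B a b HA HB HP) as (S & rr & _ & HSb & Hu & Hs).
  exists S, rr. split; [exact HSb|]. split; [exact Hu|].
  split; [intros s Hs'; destruct (Hs s Hs') as (H1 & _ & _ & H2); split; assumption|].
  intros s Hs'. destruct (Hs s Hs') as (H1 & _ & Hd & _).
  destruct (Hode _ H1) as [Hlt HdP]. destruct (HP (rr s) ltac:(lra)) as [Hpos _].
  split; [split; lra|]. split; apply is_derive_Reals; [|exact Hd].
  evar_last; [apply (is_derive_comp P rr); [exact HdP|exact Hd]|].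
  unfold scal; simpl; unfold mult; simpl. field. lra.
Qed.

(** * Uniqueness and continuation for the toy model *)

(** Boundedness is bundled in, with the same constant, so that the class is closed under
    products. *)
Definition lipschitz_on (D : R -> R -> Prop) (f : R -> R -> R) : Prop :=
  exists L, 0 <= L /\ forall x y x' y', D x y -> D x' y' ->
    Rabs (f x y) <= L /\ Rabs (f x y - f x' y') <= L * (Rabs (x - x') + Rabs (y - y')).

Lemma lipschitz_on_const (D : R -> R -> Prop) (c : R) : lipschitz_on D (fun _ _ => c).
Proof.
  exists (Rabs c). split; [apply Rabs_pos|]. intros. split; [lra|].
  rewrite Rminus_diag, Rabs_R0. apply Rmult_le_pos; [apply Rabs_pos|].
  pose proof (Rabs_pos (x - x')). pose proof (Rabs_pos (y - y')). lra.
Qed.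

Lemma lipschitz_on_plus (D : R -> R -> Prop) (f1 f2 : R -> R -> R) :
  lipschitz_on D f1 -> lipschitz_on D f2 -> lipschitz_on D (fun x y => f1 x y + f2 x y).
Proof.
  intros (L1 & P1 & H1) (L2 & P2 & H2). exists (L1 + L2). split; [lra|].
  intros x y x' y' Hd Hd'. destruct (H1 _ _ _ _ Hd Hd') as [A1 B1].
  destruct (H2 _ _ _ _ Hd Hd') as [A2 B2]. split.
  - eapply Rle_trans; [apply Rabs_triang|]. lra.
  - replace (f1 x y + f2 x y - (f1 x' y' + f2 x' y'))
      with ((f1 x y - f1 x' y') + (f2 x y - f2 x' y')) by ring.
    eapply Rle_trans; [apply Rabs_triang|]. lra.
Qed.

Lemma lipschitz_on_mult (D : R -> R -> Prop) (f1 f2 : R -> R -> R) :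
  lipschitz_on D f1 -> lipschitz_on D f2 -> lipschitz_on D (fun x y => f1 x y * f2 x y).
Proof.
  intros (L1 & P1 & H1) (L2 & P2 & H2). exists (2 * (L1 * L2)).
  assert (HL : 0 <= L1 * L2) by (apply Rmult_le_pos; assumption). split; [lra|].
  intros x y x' y' Hd Hd'. destruct (H1 _ _ _ _ Hd Hd') as [A1 B1].
  destruct (H2 _ _ _ _ Hd Hd') as [A2 B2].
  destruct (H2 _ _ _ _ Hd' Hd) as [A2' _]. split.
  - rewrite Rabs_mult.
    apply Rle_trans with (L1 * L2); [apply Rmult_le_compat; try apply Rabs_pos; assumption|lra].
  - replace (f1 x y * f2 x y - f1 x' y' * f2 x' y')
      with (f1 x y * (f2 x y - f2 x' y') + (f1 x y - f1 x' y') * f2 x' y') by ring.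
    eapply Rle_trans; [apply Rabs_triang|]. rewrite !Rabs_mult.
    set (d := Rabs (x - x') + Rabs (y - y')) in *.
    assert (Rabs (f1 x y) * Rabs (f2 x y - f2 x' y') <= L1 * (L2 * d))
      by (apply Rmult_le_compat; try apply Rabs_pos; assumption).
    assert (Rabs (f1 x y - f1 x' y') * Rabs (f2 x' y') <= (L1 * d) * L2)
      by (apply Rmult_le_compat; try apply Rabs_pos; assumption).
    lra.
Qed.

Lemma lipschitz_on_comp (D : R -> R -> Prop) (f : R -> R -> R) (F : R -> R) (E : R -> Prop) (K : R) :
  0 <= K -> (forall u v, E u -> E v -> Rabs (F u) <= K /\ Rabs (F u - F v) <= K * Rabs (u - v)) ->
  (forall x y, D x y -> E (f x y)) ->
  lipschitz_on D f -> lipschitz_on D (fun x y => F (f x y)).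
Proof.
  intros HK HF HE (L & P & H). exists (K + K * L).
  assert (HKL : 0 <= K * L) by (apply Rmult_le_pos; assumption). split; [lra|].
  intros x y x' y' Hd Hd'. destruct (H _ _ _ _ Hd Hd') as [A B].
  destruct (HF _ _ (HE _ _ Hd) (HE _ _ Hd')) as [A' B']. split; [lra|].
  eapply Rle_trans; [exact B'|].
  pose proof (Rabs_pos (x - x')). pose proof (Rabs_pos (y - y')).
  set (d := Rabs (x - x') + Rabs (y - y')) in *.
  assert (K * Rabs (f x y - f x' y') <= K * (L * d)) by (apply Rmult_le_compat_l; assumption).
  assert (0 <= K * d) by (apply Rmult_le_pos; unfold d; lra). lra.
Qed.

Definition box (c m M : R) (x y : R) : Prop := Rabs x <= c /\ m <= y <= M.

Lemma analytic_lipschitz (g : R -> R) (a b : R) :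
  analytic_on (fun _ => True) g -> a <= b ->
  exists K, 0 <= K /\ forall u v, a <= u <= b -> a <= v <= b ->
    Rabs (g u) <= K /\ Rabs (g u - g v) <= K * Rabs (u - v).
Proof.
  intros Hg Hab.
  assert (Hbound : forall f, (forall x, continuous f x) ->
            exists K, 0 <= K /\ forall x, a <= x <= b -> Rabs (f x) <= K).
  { intros f Hf. destruct (continuity_ab_maj (fun x => Rabs (f x)) a b Hab) as (Mx & HM & _).
    - intros c _. apply continuity_pt_filterlim.
      apply (continuous_comp f Rabs); [apply Hf|apply continuous_Rabs].
    - exists (Rabs (f Mx)). split; [apply Rabs_pos|exact HM]. }
  destruct (Hbound g (fun x => analytic_on_continuous g x Hg)) as (K1 & HK1 & B1).
  destruct (Hbound (Derive g) (fun x => analytic_on_continuous_Derive g x Hg)) as (K2 & HK2 & B2).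
  exists (K1 + K2). split; [lra|]. intros u v Hu Hv. split; [specialize (B1 u Hu); lra|].
  destruct (MVT_gen g v u (Derive g)) as (c & Hc & Hd).
  - intros x _. apply Derive_correct, (analytic_on_ex_derive _ g x Hg I).
  - intros x _. apply continuity_pt_filterlim, analytic_on_continuous, Hg.
  - rewrite Hd, Rabs_mult. apply Rmult_le_compat_r; [apply Rabs_pos|].
    assert (Hcab : a <= c <= b).
    { pose proof (Rmin_glb v u a). pose proof (Rmax_lub v u b). lra. }
    specialize (B2 c Hcab). lra.
Qed.

(** The bound c < 1 keeps 1 - rho^2 away from 0, where the square root is not Lipschitz, and m > 0
    controls 1/r. The rest is closure under sums, products and composition. *)
Lemma toyF_lipschitz (beta : R) (g : R -> R) (c m M : R) :
  analytic_on (fun _ => True) g -> 0 <= c < 1 -> 0 < m <= M ->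
  lipschitz_on (box c m M) (toyF beta g).
Proof.
  intros Hg Hc Hm. set (D := box c m M).
  assert (Lx : lipschitz_on D (fun x _ => x)).
  { exists 1. split; [lra|]. intros x y x' y' [H1 _] _.
    pose proof (Rabs_pos (y - y')). split; lra. }
  assert (Ly : lipschitz_on D (fun _ y => y)).
  { exists (1 + M). split; [lra|]. intros x y x' y' [_ H1] _.
    pose proof (Rabs_pos (y - y')). pose proof (Rabs_pos (x - x')).
    split; [rewrite Rabs_pos_eq; lra|nra]. }
  assert (Lx2 : lipschitz_on D (fun x _ => 1 + -1 * (x * x))).
  { repeat first [apply lipschitz_on_plus | apply lipschitz_on_mult | apply lipschitz_on_const | exact Lx]. }
  assert (Ly2 : lipschitz_on D (fun _ y => y * y)) by (apply lipschitz_on_mult; exact Ly).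
  assert (Linv : lipschitz_on D (fun _ y => / y)).
  { apply (lipschitz_on_comp D (fun _ y => y) Rinv (fun y => m <= y) (/ m + / m * / m)); [| | |exact Ly].
    - assert (0 < / m) by (apply Rinv_0_lt_compat; lra). nra.
    - intros u v Hu Hv.
      assert (I0 : 0 < / m) by (apply Rinv_0_lt_compat; lra).
      assert (Iu : 0 < / u <= / m) by (split; [apply Rinv_0_lt_compat; lra|apply Rinv_le_contravar; lra]).
      assert (Iv : 0 < / v <= / m) by (split; [apply Rinv_0_lt_compat; lra|apply Rinv_le_contravar; lra]).
      split; [rewrite Rabs_pos_eq; nra|].
      replace (/ u - / v) with (- (/ u * / v * (u - v))) by (field; lra).
      rewrite Rabs_Ropp, Rabs_mult, Rabs_pos_eq by nra.
      apply Rmult_le_compat_r; [apply Rabs_pos|]. nra.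
    - intros x y [_ H]. lra. }
  assert (Lsqrt : lipschitz_on D (fun x _ => sqrt (1 + -1 * (x * x)))).
  { set (e := 1 - c * c). assert (He : 0 < e <= 1) by (unfold e; nra).
    assert (Hse : 0 < sqrt e) by (apply sqrt_lt_R0; lra).
    apply (lipschitz_on_comp D (fun x _ => 1 + -1 * (x * x)) sqrt (fun u => e <= u <= 1)
             (1 + / sqrt e)); [| | |exact Lx2].
    - pose proof (Rinv_0_lt_compat _ Hse). lra.
    - intros u v Hu Hv. pose proof (Rinv_0_lt_compat _ Hse) as Hi.
      assert (Su : sqrt e <= sqrt u <= 1)
        by (split; [apply sqrt_le_1_alt; lra|rewrite <- sqrt_1; apply sqrt_le_1_alt; lra]).
      assert (Sv : sqrt e <= sqrt v) by (apply sqrt_le_1_alt; lra).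
      split; [rewrite Rabs_pos_eq; lra|].
      replace (sqrt u - sqrt v) with (/ (sqrt u + sqrt v) * (u - v)).
      + rewrite Rabs_mult, Rabs_pos_eq by (apply Rlt_le, Rinv_0_lt_compat; lra).
        apply Rmult_le_compat_r; [apply Rabs_pos|].
        assert (/ (sqrt u + sqrt v) <= / sqrt e) by (apply Rinv_le_contravar; lra). lra.
      + rewrite <- (sqrt_sqrt u) at 2 by lra. rewrite <- (sqrt_sqrt v) at 2 by lra.
        field. lra.
    - intros x y [H _]. apply Rabs_le_between in H. unfold e. nra. }
  assert (Lg : lipschitz_on D (fun _ y => g (y * y))).
  { destruct (analytic_lipschitz g (m * m) (M * M) Hg) as (K & HK & HL); [nra|].
    apply (lipschitz_on_comp D (fun _ y => y * y) g (fun u => m * m <= u <= M * M) K HK HL);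
      [|exact Ly2].
    intros x y [_ H]. split; nra. }
  assert (Lall : lipschitz_on D (fun x y => 3 / 2 * ((1 + -1 * (x * x)) * / y *
     (-1 + sqrt (1 + -1 * (x * x)) * (beta * (y * y) * g (y * y) + x) * / y)))).
  { repeat first [exact Lsqrt | exact Linv | exact Lg | exact Lx | exact Ly
     | apply lipschitz_on_plus | apply lipschitz_on_mult | apply lipschitz_on_const]. }
  destruct Lall as (L & HL & H). exists L. split; [exact HL|].
  assert (E : forall x y, toyF beta g x y = 3 / 2 * ((1 + -1 * (x * x)) * / y *
     (-1 + sqrt (1 + -1 * (x * x)) * (beta * (y * y) * g (y * y) + x) * / y))).
  { intros x y. unfold toyF. replace (1 - x ^ 2) with (1 + -1 * (x * x)) by ring.
    replace (y ^ 2) with (y * y) by ring. unfold Rdiv. ring. }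
  intros x y x' y' Hd Hd'. rewrite !E. apply H; assumption.
Qed.

(** Both directions of time are covered: exp(-K x) V(x) does not increase and exp(K x) V(x) does not
    decrease. *)
Lemma gronwall_zero (V dV : R -> R) (K a b t0 t : R) :
  a <= t0 <= b -> a <= t <= b ->
  (forall x, a <= x <= b -> is_derive V x (dV x)) ->
  (forall x, a <= x <= b -> Rabs (dV x) <= K * V x) ->
  V t0 = 0 -> V t <= 0.
Proof.
  intros Ht0 Ht Hd Hb H0.
  assert (Hexp : forall c x, is_derive (fun x => exp (c * x)) x (c * exp (c * x))).
  { intros c x. auto_derive; [trivial|ring]. }
  assert (HdV : forall c x, a <= x <= b ->
            is_derive (fun x => V x * exp (c * x)) x ((dV x + c * V x) * exp (c * x))).
  { intros c x Hx. evar_last.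
    - apply (is_derive_mult V (fun x => exp (c * x))); [apply Hd, Hx|apply Hexp|intros; apply Rmult_comm].
    - unfold plus; simpl; unfold mult; simpl. ring. }
  destruct (Rle_dec t0 t) as [Hle|Hle].
  - assert (H : V t * exp (- K * t) <= V t0 * exp (- K * t0)).
    { apply (derive_nonpos_le (fun x => V x * exp (- K * x))
        (fun x => (dV x + - K * V x) * exp (- K * x)) t0 t Hle).
      - intros x Hx. apply HdV. lra.
      - intros x Hx. specialize (Hb x ltac:(lra)). apply Rabs_le_between in Hb.
        pose proof (exp_pos (- K * x)). nra. }
    rewrite H0 in H. pose proof (exp_pos (- K * t)). nra.
  - assert (H : - (V t0 * exp (K * t0)) <= - (V t * exp (K * t))).
    { apply (derive_nonpos_le (fun x => - (V x * exp (K * x)))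
        (fun x => - ((dV x + K * V x) * exp (K * x))) t t0 ltac:(lra)).
      - intros x Hx. apply (is_derive_opp (fun x => V x * exp (K * x))), HdV. lra.
      - intros x Hx. specialize (Hb x ltac:(lra)). apply Rabs_le_between in Hb.
        pose proof (exp_pos (K * x)). nra. }
    rewrite H0 in H. pose proof (exp_pos (K * t)). nra.
Qed.

Lemma toy_sol_box (beta : R) (g : R -> R) (D : R -> Prop) (rho r : R -> R) (a b : R) :
  a <= b -> toy_sol beta g D rho r -> (forall x, a <= x <= b -> D x) ->
  exists c m M, 0 <= c < 1 /\ 0 < m <= M /\ forall x, a <= x <= b -> box c m M (rho x) (r x).
Proof.
  intros Hab Hs HD.
  assert (Cr : forall x, a <= x <= b -> continuity_pt r x).
  { intros x Hx. destruct (Hs x (HD x Hx)) as (_ & _ & H). apply derivable_continuous_pt.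
    eexists; exact H. }
  assert (Cp : forall x, a <= x <= b -> continuity_pt (fun x => Rabs (rho x)) x).
  { intros x Hx. destruct (Hs x (HD x Hx)) as (_ & H & _).
    apply continuity_pt_filterlim. apply (continuous_comp rho Rabs); [|apply continuous_Rabs].
    apply (ex_derive_continuous rho). eexists. apply is_derive_Reals, H. }
  destruct (continuity_ab_maj _ a b Hab Cp) as (x1 & H1 & D1).
  destruct (continuity_ab_maj _ a b Hab Cr) as (x2 & H2 & D2).
  destruct (continuity_ab_min _ a b Hab Cr) as (x3 & H3 & D3).
  exists (Rabs (rho x1)), (r x3), (r x2).
  destruct (Hs x1 (HD x1 D1)) as ([Hr1 _] & _). destruct (Hs x3 (HD x3 D3)) as ([_ Hr3] & _).
  split; [split; [apply Rabs_pos|apply Rabs_def1; lra]|].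
  split; [split; [exact Hr3|apply H2, D3]|].
  intros x Hx. split; [apply H1, Hx|]. split; [apply H3, Hx|apply H2, Hx].
Qed.

Lemma toy_sol_unique (beta : R) (g : R -> R) (D1 D2 : R -> Prop) (rho1 r1 rho2 r2 : R -> R) (a b t0 t : R) :
  analytic_on (fun _ => True) g ->
  toy_sol beta g D1 rho1 r1 -> toy_sol beta g D2 rho2 r2 ->
  (forall x, a <= x <= b -> D1 x /\ D2 x) ->
  a <= t0 <= b -> a <= t <= b -> rho1 t0 = rho2 t0 -> r1 t0 = r2 t0 ->
  rho1 t = rho2 t /\ r1 t = r2 t.
Proof.
  intros Hg S1 S2 HD Ht0 Ht E1 E2.
  destruct (toy_sol_box beta g D1 rho1 r1 a b ltac:(lra) S1 (fun x Hx => proj1 (HD x Hx)))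
    as (c1 & m1 & M1 & Hc1 & Hm1 & B1).
  destruct (toy_sol_box beta g D2 rho2 r2 a b ltac:(lra) S2 (fun x Hx => proj2 (HD x Hx)))
    as (c2 & m2 & M2 & Hc2 & Hm2 & B2).
  set (c := Rmax c1 c2). set (m := Rmin m1 m2). set (M := Rmax M1 M2).
  assert (Hc : 0 <= c < 1).
  { unfold c. split; [eapply Rle_trans; [apply Hc1|apply Rmax_l]|apply Rmax_lub_lt; lra]. }
  assert (Hm : 0 < m <= M).
  { unfold m, M. pose proof (Rmin_l m1 m2). pose proof (Rmax_l M1 M2).
    split; [apply Rmin_glb_lt; lra|lra]. }
  assert (Hbox1 : forall x, a <= x <= b -> box c m M (rho1 x) (r1 x)).
  { intros x Hx. destruct (B1 x Hx) as [P Q]. unfold box, c, m, M.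
    pose proof (Rmax_l c1 c2). pose proof (Rmin_l m1 m2). pose proof (Rmax_l M1 M2). lra. }
  assert (Hbox2 : forall x, a <= x <= b -> box c m M (rho2 x) (r2 x)).
  { intros x Hx. destruct (B2 x Hx) as [P Q]. unfold box, c, m, M.
    pose proof (Rmax_r c1 c2). pose proof (Rmin_r m1 m2). pose proof (Rmax_r M1 M2). lra. }
  destruct (toyF_lipschitz beta g c m M Hg Hc Hm) as (L & HL & Hlip).
  (* Gronwall for the squared distance. With u, v the absolute differences, its derivative is at
     most 2 u L (u + v) + 2 u v, and 2 u v <= u^2 + v^2 bounds this by (4 L + 2)(u^2 + v^2). *)
  assert (HV : (rho1 t - rho2 t) ^ 2 + (r1 t - r2 t) ^ 2 <= 0).
  { apply (gronwall_zero (fun x => (rho1 x - rho2 x) ^ 2 + (r1 x - r2 x) ^ 2)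
      (fun x => 2 * (rho1 x - rho2 x) * (toyF beta g (rho1 x) (r1 x) - toyF beta g (rho2 x) (r2 x))
                + 2 * (r1 x - r2 x) * (rho1 x - rho2 x)) (4 * L + 2) a b t0 t Ht0 Ht).
    - intros x Hx. destruct (HD x Hx) as [X1 X2].
      destruct (S1 x X1) as (_ & P1 & Q1). destruct (S2 x X2) as (_ & P2 & Q2).
      apply is_derive_Reals in P1, Q1, P2, Q2. evar_last.
      + apply (is_derive_plus (fun x => (rho1 x - rho2 x) ^ 2) (fun x => (r1 x - r2 x) ^ 2)).
        * apply (is_derive_pow (fun x => rho1 x - rho2 x) 2), (is_derive_minus rho1 rho2); eassumption.
        * apply (is_derive_pow (fun x => r1 x - r2 x) 2), (is_derive_minus r1 r2); eassumption.
      + unfold minus, plus, opp; simpl. ring.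
    - intros x Hx. destruct (Hlip _ _ _ _ (Hbox1 x Hx) (Hbox2 x Hx)) as [_ HF].
      set (p := rho1 x - rho2 x) in *. set (q := r1 x - r2 x) in *.
      set (F := toyF beta g (rho1 x) (r1 x) - toyF beta g (rho2 x) (r2 x)) in *.
      eapply Rle_trans; [apply Rabs_triang|]. rewrite !Rabs_mult, (Rabs_pos_eq 2) by lra.
      rewrite <- (pow2_abs p), <- (pow2_abs q).
      pose proof (Rabs_pos p) as Hp. pose proof (Rabs_pos q) as Hq.
      set (u := Rabs p) in *. set (v := Rabs q) in *.
      assert (u * Rabs F <= u * (L * (u + v))) by (apply Rmult_le_compat_l; assumption).
      assert (2 * (u * v) <= u ^ 2 + v ^ 2) by (pose proof (pow2_ge_0 (u - v)); lra).
      assert (L * (2 * (u * v)) <= L * (u ^ 2 + v ^ 2)) by (apply Rmult_le_compat_l; assumption).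
      assert (0 <= L * v ^ 2) by (apply Rmult_le_pos; [exact HL|apply pow2_ge_0]).
      assert (0 <= L * u ^ 2) by (apply Rmult_le_pos; [exact HL|apply pow2_ge_0]).
      pose proof (pow2_ge_0 u). pose proof (pow2_ge_0 v). lra.
    - rewrite E1, E2. ring. }
  pose proof (pow2_ge_0 (rho1 t - rho2 t)). pose proof (pow2_ge_0 (r1 t - r2 t)).
  assert (X : (rho1 t - rho2 t) ^ 2 = 0) by lra. assert (Y : (r1 t - r2 t) ^ 2 = 0) by lra.
  split; apply Rminus_diag_uniq; [destruct (Req_dec (rho1 t - rho2 t) 0) as [|N]|
    destruct (Req_dec (r1 t - r2 t) 0) as [|N]]; try assumption;
    apply (pow_nonzero _ 2) in N; contradiction.
Qed.

(** * Translation, gluing and maximality *)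

Definition shift_end (c : R) (e : option R) : option R := option_map (fun x => x + c) e.

Lemma in_oint_shift (lo hi : option R) (c s : R) :
  in_oint (shift_end c lo) (shift_end c hi) s <-> in_oint lo hi (s - c).
Proof. destruct lo, hi; simpl; unfold in_oint; split; intros [H1 H2]; split; trivial; lra. Qed.

Lemma in_oint_convex (lo hi : option R) (x y z : R) :
  in_oint lo hi x -> in_oint lo hi y -> x <= z <= y -> in_oint lo hi z.
Proof. destruct lo, hi; unfold in_oint; intros [H1 H2] [H3 H4] H5; split; trivial; lra. Qed.

Lemma toy_sol_shift (beta : R) (g : R -> R) (D : R -> Prop) (rho r : R -> R) (c : R) :
  toy_sol beta g D rho r ->
  toy_sol beta g (fun s => D (s + c)) (fun s => rho (s + c)) (fun s => r (s + c)).
Proof.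
  intros H s Hs. destruct (H (s + c) Hs) as (H1 & H2 & H3). split; [exact H1|].
  apply is_derive_Reals in H2, H3.
  assert (Hd : is_derive (fun s => s + c) s 1) by (auto_derive; [trivial|ring]).
  split; apply is_derive_Reals; evar_last;
    [apply (is_derive_comp rho (fun s => s + c)); eassumption|
    |apply (is_derive_comp r (fun s => s + c)); eassumption|];
    unfold scal; simpl; unfold mult; simpl; ring.
Qed.

Lemma toy_sol_subdomain (beta : R) (g : R -> R) (D D' : R -> Prop) (rho r : R -> R) :
  (forall s, D' s -> D s) -> toy_sol beta g D rho r -> toy_sol beta g D' rho r.
Proof. intros HD H s Hs. apply H, HD, Hs. Qed.

Lemma toy_max_sol_shift (beta : R) (g : R -> R) (lo hi : option R) (rho r : R -> R) (c : R) :
  toy_max_sol beta g lo hi rho r ->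
  toy_max_sol beta g (shift_end (- c) lo) (shift_end (- c) hi)
    (fun s => rho (s + c)) (fun s => r (s + c)).
Proof.
  intros ((s0 & Hs0) & Hsol & Hmax). split; [|split].
  - exists (s0 - c). apply in_oint_shift. replace (s0 - c - - c) with s0 by ring. exact Hs0.
  - apply (toy_sol_subdomain _ _ (fun s => in_oint lo hi (s + c))).
    + intros s Hs. apply in_oint_shift in Hs. replace (s + c) with (s - - c) by ring. exact Hs.
    + apply toy_sol_shift, Hsol.
  - intros lo' hi' rho' r' Hsol' Hext s Hs. apply in_oint_shift.
    apply (Hmax (shift_end c lo') (shift_end c hi') (fun s => rho' (s + - c)) (fun s => r' (s + - c))).
    + apply (toy_sol_subdomain _ _ (fun s => in_oint lo' hi' (s + - c))).
      * intros u Hu. apply in_oint_shift in Hu. exact Hu.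
      * apply toy_sol_shift, Hsol'.
    + intros u Hu. destruct (Hext (u - c)) as (H1 & H2 & H3).
      * apply in_oint_shift. replace (u - c - - c) with u by ring. exact Hu.
      * replace (u - c + c) with u in H2, H3 by ring.
        split; [apply in_oint_shift; exact H1|]. split; assumption.
    + apply in_oint_shift. replace (s - - c - c) with s by ring. exact Hs.
Qed.

Lemma in_oint_open (lo hi : option R) (s : R) :
  in_oint lo hi s -> locally s (in_oint lo hi).
Proof.
  intros [H1 H2]. apply filter_and.
  - destruct lo as [a|]; [apply (open_gt a s H1)|apply filter_forall; trivial].
  - destruct hi as [b|]; [apply (open_lt b s H2)|apply filter_forall; trivial].
Qed.

(** Being a solution is a local property; this is the gluing principle for two solutions that agree
    on their overlap. *)
Lemma toy_sol_local (beta : R) (g : R -> R) (D : R -> Prop) (rho r : R -> R) :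
  (forall s, D s -> exists lo hi rho1 r1, in_oint lo hi s /\
     toy_sol beta g (in_oint lo hi) rho1 r1 /\
     forall x, in_oint lo hi x -> rho x = rho1 x /\ r x = r1 x) ->
  toy_sol beta g D rho r.
Proof.
  intros H s Hs. destruct (H s Hs) as (lo & hi & rho1 & r1 & Hin & Hsol & Heq).
  destruct (Hsol s Hin) as (H1 & H2 & H3). destruct (Heq s Hin) as [-> ->].
  apply is_derive_Reals in H2, H3.
  split; [exact H1|]. split; apply is_derive_Reals.
  - apply (is_derive_ext_loc rho1); [|exact H2].
    apply (filter_imp (in_oint lo hi)); [|apply in_oint_open, Hin].
    intros x Hx. symmetry. apply Heq, Hx.
  - apply (is_derive_ext_loc r1); [|exact H3].
    apply (filter_imp (in_oint lo hi)); [|apply in_oint_open, Hin].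
    intros x Hx. symmetry. apply Heq, Hx.
Qed.

Definition lo_union (l1 l2 : option R) : option R :=
  match l1, l2 with Some a, Some b => Some (Rmin a b) | _, _ => None end.

Definition hi_union (h1 h2 : option R) : option R :=
  match h1, h2 with Some a, Some b => Some (Rmax a b) | _, _ => None end.

(** The common point s0 is what makes the convex hull of the two intervals equal to their union. *)
Lemma in_oint_union (lo hi lo2 hi2 : option R) (s0 s : R) :
  in_oint lo hi s0 -> in_oint lo2 hi2 s0 ->
  in_oint (lo_union lo lo2) (hi_union hi hi2) s <-> in_oint lo hi s \/ in_oint lo2 hi2 s.
Proof.
  intros [A1 A2] [B1 B2]. unfold in_oint, lo_union, hi_union, Rmin, Rmax.
  destruct (Rle_dec s s0) as [Hs|Hs];
    destruct lo as [a|], hi as [b|], lo2 as [a2|], hi2 as [b2|]; simpl in *;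
    repeat match goal with |- context [Rle_dec ?x ?y] => destruct (Rle_dec x y) end;
    (split; [intros [H1 H2];
             first [left; split; solve [trivial | lra] | right; split; solve [trivial | lra]]
            |intros [[H1 H2]|[H1 H2]]; split; solve [trivial | lra]]).
Qed.

(** Uniqueness makes the two solutions agree on the overlap, so they glue to a solution on the
    union. Maximality of the first then puts the second interval inside the first. *)
Lemma toy_max_sol_extends (beta : R) (g : R -> R) (lo hi lo2 hi2 : option R)
    (rho r rho2 r2 : R -> R) (s0 : R) :
  analytic_on (fun _ => True) g ->
  toy_max_sol beta g lo hi rho r -> toy_sol beta g (in_oint lo2 hi2) rho2 r2 ->
  in_oint lo hi s0 -> in_oint lo2 hi2 s0 -> rho s0 = rho2 s0 -> r s0 = r2 s0 ->
  forall u, in_oint lo2 hi2 u -> in_oint lo hi u /\ rho u = rho2 u /\ r u = r2 u.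
Proof.
  intros Hg (_ & Hsol & Hmax) Hsol2 H0 H02 E1 E2.
  assert (Heq : forall u, in_oint lo hi u -> in_oint lo2 hi2 u -> rho u = rho2 u /\ r u = r2 u).
  { intros u Hu Hu2.
    destruct (Rle_dec s0 u) as [Hle|Hle].
    - apply (toy_sol_unique beta g _ _ rho r rho2 r2 s0 u s0 u Hg Hsol Hsol2); try assumption; try lra.
      intros x Hx. split; [apply (in_oint_convex lo hi s0 u)|apply (in_oint_convex lo2 hi2 s0 u)]; assumption.
    - apply (toy_sol_unique beta g _ _ rho r rho2 r2 u s0 s0 u Hg Hsol Hsol2); try assumption; try lra.
      intros x Hx. split; [apply (in_oint_convex lo hi u s0)|apply (in_oint_convex lo2 hi2 u s0)]; assumption. }
  set (sel := fun (f f2 : R -> R) s =>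
    if excluded_middle_informative (in_oint lo hi s) then f s else f2 s).
  assert (HselI : forall f f2 s, in_oint lo hi s -> sel f f2 s = f s).
  { intros f f2 s Hs. unfold sel. destruct (excluded_middle_informative _); [reflexivity|contradiction]. }
  assert (HselJ : forall s, in_oint lo2 hi2 s -> sel rho rho2 s = rho2 s /\ sel r r2 s = r2 s).
  { intros s Hs. unfold sel. destruct (excluded_middle_informative _); [apply Heq; assumption|].
    split; reflexivity. }
  assert (Hin : forall u, in_oint lo2 hi2 u -> in_oint lo hi u).
  { intros u Hu.
    apply (Hmax (lo_union lo lo2) (hi_union hi hi2) (sel rho rho2) (sel r r2)).
    - apply toy_sol_local. intros s Hs.
      apply (in_oint_union lo hi lo2 hi2 s0 s H0 H02) in Hs. destruct Hs as [Hs|Hs].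
      + exists lo, hi, rho, r. split; [exact Hs|]. split; [exact Hsol|].
        intros x Hx. split; apply HselI, Hx.
      + exists lo2, hi2, rho2, r2. split; [exact Hs|]. split; [exact Hsol2|]. exact HselJ.
    - intros s Hs. split; [|split; apply HselI, Hs].
      apply (in_oint_union lo hi lo2 hi2 s0 s H0 H02). left. exact Hs.
    - apply (in_oint_union lo hi lo2 hi2 s0 u H0 H02). right. exact Hu. }
  intros u Hu. split; [apply Hin, Hu|apply Heq; [apply Hin|]; exact Hu].
Qed.

(** The system is autonomous, so a common phase point taken at different times s0 and u0 suffices
    after translation by s0 - u0. *)
Lemma toy_max_sol_contains (beta : R) (g : R -> R) (lo hi lo2 hi2 : option R)
    (rho r rho2 r2 : R -> R) (s0 u0 : R) :
  analytic_on (fun _ => True) g ->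
  toy_max_sol beta g lo hi rho r -> toy_sol beta g (in_oint lo2 hi2) rho2 r2 ->
  in_oint lo hi s0 -> in_oint lo2 hi2 u0 -> rho s0 = rho2 u0 -> r s0 = r2 u0 ->
  forall u, in_oint lo2 hi2 u -> in_oint lo hi (u + (s0 - u0)) /\
    rho (u + (s0 - u0)) = rho2 u /\ r (u + (s0 - u0)) = r2 u.
Proof.
  intros Hg Hmax Hsol2 H0 H02 E1 E2 u Hu.
  destruct (toy_max_sol_extends beta g _ _ lo2 hi2 _ _ rho2 r2 u0 Hg
    (toy_max_sol_shift beta g lo hi rho r (s0 - u0) Hmax) Hsol2) with (u := u) as (A & B & C).
  - apply in_oint_shift. replace (u0 - - (s0 - u0)) with s0 by ring. exact H0.
  - exact H02.
  - replace (u0 + (s0 - u0)) with s0 by ring. exact E1.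
  - replace (u0 + (s0 - u0)) with s0 by ring. exact E2.
  - exact Hu.
  - apply in_oint_shift in A. replace (u - - (s0 - u0)) with (u + (s0 - u0)) in A by ring.
    split; [exact A|]. split; assumption.
Qed.

(** * Maximal solutions that meet W^loc *)

Lemma pow2_lt_of_lt_sqrt (x e : R) : 0 < e -> - sqrt e < x < sqrt e -> 0 <= x ^ 2 < e.
Proof.
  intros He Hx. split; [apply pow2_ge_0|].
  pose proof (sqrt_sqrt e (Rlt_le _ _ He)). nra.
Qed.

Lemma Wloc_profile (beta : R) (g : R -> R) (p q : R) :
  Wloc beta g p q ->
  exists (W : R) (h : R -> R), q ^ 2 < W /\ profile beta g W h /\ lim_right0 h (1 / 3) /\
    profile_rho h q = p.
Proof.
  intros ((Hp & Hq) & HW & _).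
  assert (Hq2 : 0 < q ^ 2) by (apply pow_lt, Hq).
  destruct (Wu_profile beta g _ _ HW Hq2) as (W & h & HqW & Hh & HL & E).
  exists W, h. split; [exact HqW|]. split; [exact Hh|]. split; [exact HL|].
  unfold profile_rho. rewrite E.
  replace (1 - (sqrt (1 - p ^ 2) / q) ^ 2 * q ^ 2) with (Rsqr p).
  - apply sqrt_Rsqr. lra.
  - assert (Hs : sqrt (1 - p ^ 2) * sqrt (1 - p ^ 2) = 1 - p ^ 2) by (apply sqrt_sqrt; nra).
    replace ((sqrt (1 - p ^ 2) / q) ^ 2 * q ^ 2)
      with (sqrt (1 - p ^ 2) * sqrt (1 - p ^ 2)) by (field; lra).
    rewrite Hs. unfold Rsqr. ring.
Qed.

(** The profile through the point of W^loc lifts to a solution passing through any prescribed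
    smaller radius, and the maximal solution contains a translate of that lift. *)
Lemma Wloc_descends (beta : R) (g : R -> R) (lo hi : option R) (rho r : R -> R) (s0 : R) :
  analytic_on (fun _ => True) g ->
  toy_max_sol beta g lo hi rho r -> in_oint lo hi s0 -> Wloc beta g (rho s0) (r s0) ->
  exists (W : R) (h : R -> R), profile beta g W h /\ lim_right0 h (1 / 3) /\
    forall r1, 0 < r1 < r s0 -> exists s1, in_oint lo hi s1 /\ r s1 = r1 /\ rho s1 = profile_rho h r1.
Proof.
  intros Hg Hmax Hs0 HWl.
  assert (Hr0 : 0 < r s0) by apply HWl.
  destruct (Wloc_profile beta g _ _ HWl) as (W & h & HqW & Hh & HL & E).
  exists W, h. split; [exact Hh|]. split; [exact HL|]. intros r1 Hr1.
  assert (HW : 0 < W) by apply Hh.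
  assert (Hsq : r s0 < sqrt W).
  { rewrite <- (sqrt_pow2 (r s0)) by lra. apply sqrt_lt_1_alt. split; [apply pow2_ge_0|exact HqW]. }
  assert (Hode : forall x, 0 < x < sqrt W -> 0 < profile_rho h x < 1 /\
     is_derive (profile_rho h) x (toyF beta g (profile_rho h x) x / profile_rho h x)).
  { intros x Hx. apply (profile_rho_ode beta g h W); [exact Hh|lra|].
    apply pow2_lt_of_lt_sqrt; [exact HW|]. lra. }
  (* These ends put both r1 and r s0 strictly inside the lifted range, itself away from r = 0 and
     from sqrt W. *)
  destruct (toy_lift beta g (profile_rho h) 0 (sqrt W) (r1 / 2) ((r s0 + sqrt W) / 2))
    as (S & rr & HSb & Hu & _ & Hsol); [lra|lra|lra| | |].
  - intros x Hx. destruct (Hode x Hx) as [H1 H2]. split; [lra|].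
    apply (ex_derive_continuous (profile_rho h)). eexists; exact H2.
  - intros x Hx. destruct (Hode x ltac:(lra)) as [H1 H2]. split; [lra|exact H2].
  - destruct (Hu (r s0) ltac:(lra)) as [I0 E0]. destruct (Hu r1 ltac:(lra)) as [I1 E1].
    destruct (toy_max_sol_contains beta g lo hi (Some 0) (Some (S ((r s0 + sqrt W) / 2)))
      rho r (fun s => profile_rho h (rr s)) rr s0 (S (r s0)) Hg Hmax Hsol Hs0 I0)
      with (u := S r1) as (A & B & C).
    + rewrite E0, E. reflexivity.
    + rewrite E0. reflexivity.
    + exact I1.
    + exists (S r1 + (s0 - S (r s0))). split; [exact A|]. rewrite B, C, E1. split; reflexivity.
Qed.

Lemma profile_rho_sqrt (h : R -> R) (r : R) :
  0 < r -> 0 < h (r ^ 2) -> h (r ^ 2) ^ 2 * r ^ 2 < 1 ->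
  sqrt (1 - profile_rho h r ^ 2) / r = h (r ^ 2).
Proof.
  intros Hr Hh HN.
  replace (1 - profile_rho h r ^ 2) with (Rsqr (h (r ^ 2) * r)).
  - rewrite sqrt_Rsqr; [field; lra|]. apply Rlt_le, Rmult_lt_0_compat; assumption.
  - unfold Rsqr.
    replace (profile_rho h r ^ 2) with (profile_rho h r * profile_rho h r) by ring.
    unfold profile_rho. rewrite sqrt_sqrt by lra. ring.
Qed.

(* The germ (ps, rs) does not depend on the maximal solution: this is what makes any two
   maximal solutions meeting W^loc translates of each other. *)
Lemma canonical_tip (beta : R) (g : R -> R) :
  analytic_on (fun _ => True) g ->
  exists (sig eps : R) (ps rs G : R -> R),
    0 < sig /\ lim_right0 rs 0 /\
    (forall s, 0 < s < sig -> 0 < rs s /\ rs s ^ 2 < eps /\ ps s = G (rs s ^ 2)) /\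
    analytic_on (fun x => - eps < x < eps) G /\ G 0 = 1 /\
    (forall x, - eps < x < eps -> 0 < G x) /\
    lim_right0 (fun s => sqrt (1 - ps s ^ 2) / rs s) (1 / 3) /\
    forall lo hi rho r s0, toy_max_sol beta g lo hi rho r -> in_oint lo hi s0 ->
      Wloc beta g (rho s0) (r s0) ->
      exists c, forall s, 0 < s < sig ->
        in_oint lo hi (s + c) /\ rho (s + c) = ps s /\ r (s + c) = rs s.
Proof.
  intros Hg. destruct (analytic_profile beta g Hg) as (eps & h & G & Heps & HGan & Hh0 & HG0 & H).
  set (B := sqrt eps). assert (HB : 0 < B) by (apply sqrt_lt_R0, Heps).
  assert (Habs : forall x, - eps < x < eps -> Rabs x < eps) by (intros; apply Rabs_def1; lra).
  assert (HGs : forall w, - eps < w < eps -> sqrt (1 - h w ^ 2 * w) = G w).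
  { intros w Hw. destruct (H w (Habs w Hw)) as (_ & H2 & H3 & _).
    rewrite <- H3. apply sqrt_pow2. lra. }
  assert (Hprof : profile beta g eps h).
  { split; [exact Heps|]. intros w Hw.
    destruct (H w (Habs w ltac:(lra))) as (H1 & H2 & H3 & d & Hd & E).
    split; [exact H1|]. split; [nra|].
    unfold etaF. rewrite HGs by lra. rewrite <- E.
    replace (2 * w * d / (2 * w)) with d by (field; lra). exact Hd. }
  assert (Hcont : forall w, - eps < w < eps -> continuous h w).
  { intros w Hw. destruct (H w (Habs w Hw)) as (_ & _ & _ & d & Hd & _).
    apply (ex_derive_continuous h). exists d. exact Hd. }
  assert (HL : lim_right0 h (1 / 3)).
  { rewrite <- Hh0. apply (lim_right0_comp (fun s => s) h); [apply lim_right0_id|apply Hcont; lra]. }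
  assert (Hx2 : forall x, - B < x < B -> 0 <= x ^ 2 < eps)
    by (intros x Hx; apply pow2_lt_of_lt_sqrt; [exact Heps|exact Hx]).
  assert (HPG : forall x, - B < x < B -> profile_rho h x = G (x ^ 2)).
  { intros x Hx. apply HGs. specialize (Hx2 x Hx). lra. }
  (* The lift starts at a = 0: on (-B, B) the right-hand side is G(x^2), positive and continuous
     across x = 0. *)
  destruct (toy_lift beta g (profile_rho h) (- B) B 0 (B / 2))
    as (S & rr & HSb & Hu & Hrr & Hsol); [lra|lra|lra| | |].
  { intros x Hx. specialize (Hx2 x Hx). split.
    - rewrite (HPG x Hx). destruct (H (x ^ 2) (Habs (x ^ 2) ltac:(lra))) as (H1 & H2 & H3 & _).
      split; [exact H2|].
      assert (0 <= h (x ^ 2) ^ 2 * x ^ 2) by (apply Rmult_le_pos; [apply pow2_ge_0|lra]). nra.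
    - apply (continuous_comp (fun x => 1 - h (x ^ 2) ^ 2 * x ^ 2) sqrt); [|apply continuous_sqrt].
      apply (ex_derive_continuous (fun x => 1 - h (x ^ 2) ^ 2 * x ^ 2)).
      destruct (H (x ^ 2) (Habs (x ^ 2) ltac:(lra))) as (_ & _ & _ & d & Hd & _).
      auto_derive. exists d. exact Hd. }
  { intros x Hx. destruct (profile_rho_ode beta g h eps x Hprof) as [H1 H2];
      [lra|apply Hx2; lra|]. split; [lra|exact H2]. }
  assert (Hlim : lim_right0 rr 0).
  { intros e He. exists (Rmin e (S (B / 2))). split; [apply Rmin_glb_lt; assumption|].
    intros s Hs. pose proof (Rmin_l e (S (B / 2))). pose proof (Rmin_r e (S (B / 2))).
    destruct (Hrr s ltac:(lra)) as [A1 A2]. rewrite Rminus_0_r, Rabs_pos_eq; lra. }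
  exists (S (B / 2)), eps, (fun s => profile_rho h (rr s)), rr, G.
  split; [exact HSb|]. split; [exact Hlim|]. split.
  { intros s Hs. destruct (Hrr s Hs) as [H1 _]. split; [lra|].
    split; [apply Hx2; lra|apply HPG; lra]. }
  split; [exact HGan|]. split; [exact HG0|].
  split; [intros x Hx; apply (H x (Habs x Hx))|]. split.
  { apply (lim_right0_ext (fun s => h (rr s * rr s)) _ _ (S (B / 2)) HSb).
    - intros s Hs. destruct (Hrr s Hs) as [H1 _].
      replace (rr s * rr s) with (rr s ^ 2) by ring. symmetry.
      destruct Hprof as [_ Hp]. pose proof (Hx2 (rr s) ltac:(lra)) as X2.
      assert (0 < rr s ^ 2) by (apply pow_lt; lra).
      destruct (Hp (rr s ^ 2) ltac:(lra)) as (P1 & P2 & _).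
      apply profile_rho_sqrt; [lra|exact P1|exact P2].
    - rewrite <- Hh0. replace 0 with (0 * 0) by ring.
      apply (lim_right0_comp (fun s => rr s * rr s) h); [apply lim_right0_mult; exact Hlim|].
      apply Hcont. lra. }
  intros lo hi rho r s0 Hmax Hs0 HWl.
  assert (Hr0 : 0 < r s0) by apply HWl.
  destruct (Wloc_descends beta g lo hi rho r s0 Hg Hmax Hs0 HWl) as (W & h' & Hp' & HL' & Hdesc).
  destruct (profile_unique beta g eps W h h' Hg Hprof HL Hp' HL') as (V & HV & Heq).
  assert (HsV : 0 < sqrt V) by (apply sqrt_lt_R0, HV).
  (* A radius that the maximal solution reaches (below r s0), that the germ reaches (below B/2), and
     at which the two profiles coincide (below sqrt V): there both have the same phase point. *)
  set (r1 := Rmin (r s0) (Rmin (B / 2) (sqrt V)) / 2).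
  assert (Hr1 : 0 < r1 /\ r1 < r s0 /\ r1 < B / 2 /\ r1 < sqrt V).
  { unfold r1. pose proof (Rmin_l (r s0) (Rmin (B / 2) (sqrt V))).
    pose proof (Rmin_r (r s0) (Rmin (B / 2) (sqrt V))).
    pose proof (Rmin_l (B / 2) (sqrt V)). pose proof (Rmin_r (B / 2) (sqrt V)).
    assert (0 < Rmin (r s0) (Rmin (B / 2) (sqrt V))) by (repeat apply Rmin_glb_lt; lra). lra. }
  destruct (Hdesc r1 ltac:(lra)) as (s1 & Hs1 & E1 & E2).
  destruct (Hu r1 ltac:(lra)) as [I1 E3].
  exists (s1 - S r1). intros s Hs.
  apply (toy_max_sol_contains beta g lo hi (Some 0) (Some (S (B / 2)))
      rho r (fun s => profile_rho h (rr s)) rr s1 (S r1) Hg Hmax Hsol Hs1 I1).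
  - rewrite E3, E2. unfold profile_rho. rewrite Heq; [reflexivity|].
    split; [apply pow_lt; lra|]. apply pow2_lt_of_lt_sqrt; [exact HV|lra].
  - rewrite E3. exact E1.
  - exact Hs.
Qed.

(** * Tip solutions *)

(** Intermediate values between t and a time u so small that r u < sqrt w. Claims about every small
    w can then be checked along the solution. *)
Lemma toy_sol_r_range (beta : R) (g : R -> R) (D : R -> Prop) (rho r : R -> R) (b : R) :
  toy_sol beta g D rho r -> lim_right0 r 0 -> (forall s, 0 < s < b -> D s) ->
  forall t w, 0 < t < b -> 0 < w < r t ^ 2 -> exists s, 0 < s < t /\ r s ^ 2 = w.
Proof.
  intros Hsol HL HD t w Ht Hw.
  assert (Hsw : 0 < sqrt w) by (apply sqrt_lt_R0; lra).
  assert (Hss : sqrt w * sqrt w = w) by (apply sqrt_sqrt; lra).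
  destruct (HL (sqrt w) Hsw) as (d & Hd & Hs).
  set (u := Rmin d t / 2).
  assert (Hu : 0 < u /\ u < t /\ u < d).
  { unfold u. pose proof (Rmin_l d t). pose proof (Rmin_r d t).
    assert (0 < Rmin d t) by (apply Rmin_glb_lt; lra). lra. }
  specialize (Hs u ltac:(lra)). rewrite Rminus_0_r in Hs. apply Rabs_def2 in Hs.
  destruct (Hsol t (HD t Ht)) as ([_ Hrt] & _).
  destruct (Ranalysis5.IVT_interv (fun x => r x - sqrt w) u t) as (s & Hs1 & Hs2).
  - intros x Hx. destruct (Hsol x (HD x ltac:(lra))) as (_ & _ & Hder).
    apply is_derive_Reals in Hder.
    apply continuity_pt_filterlim, (ex_derive_continuous (fun x => r x - sqrt w)).
    eexists. apply (is_derive_minus r (fun _ => sqrt w)); [exact Hder|apply is_derive_const].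
  - lra.
  - lra.
  - nra.
  - exists s. assert (E : r s = sqrt w) by lra. rewrite E. split; [|simpl; lra].
    split; [lra|]. destruct (Req_dec s t) as [Est|]; [|lra].
    subst s. rewrite E in Hw. simpl in Hw. lra.
Qed.

Lemma toy_tip_meets_Wloc (beta : R) (g : R -> R) (D : R -> Prop) (rho r : R -> R) :
  analytic_on (fun _ => True) g -> toy_tip beta g D rho r ->
  exists s, D s /\ Wloc beta g (rho s) (r s).
Proof.
  intros Hg (smax & _ & _ & Hsol & _ & Lr & (eta0 & He0 & Leta) &
    (s0 & G & Hs0 & HDs0 & HGan & HGpos & HGrho) & (s1 & Hs1 & Hend)).
  destruct (Hsol s0 HDs0) as ([_ Hrs0] & _).
  destruct (Lr (r s0) Hrs0) as (d & Hd & Hdr).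
  (* Before time b all conditions hold at once: r^2 lies in the domain of G, rho = G(r^2) and rho >
     0. *)
  set (b := Rmin d (Rmin s0 s1)).
  assert (Hb : 0 < b /\ b <= d /\ b <= s0 /\ b <= s1).
  { unfold b. pose proof (Rmin_l d (Rmin s0 s1)). pose proof (Rmin_r d (Rmin s0 s1)).
    pose proof (Rmin_l s0 s1). pose proof (Rmin_r s0 s1).
    split; [repeat apply Rmin_glb_lt; lra|lra]. }
  assert (HDb : forall s, 0 < s < b -> D s) by (intros s Hs; apply Hend; lra).
  assert (Hpt : forall s, 0 < s < b ->
            0 < rho s < 1 /\ 0 < r s < r s0 /\ rho s = G (r s ^ 2)).
  { intros s Hs. destruct (Hend s ltac:(lra)) as (HDs & Hrho & _).
    destruct (Hsol s HDs) as ((H1 & H2) & _).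
    specialize (Hdr s ltac:(lra)). rewrite Rminus_0_r in Hdr. apply Rabs_def2 in Hdr.
    split; [lra|]. split; [lra|]. apply HGrho. lra. }
  assert (Hrange := toy_sol_r_range beta g D rho r b Hsol Lr HDb).
  (* Since rho = G(r^2), eta is a function of w directly, without inverting r. *)
  set (h := fun w => sqrt (1 - G w ^ 2) / sqrt w).
  assert (Hh : forall s, 0 < s < b -> h (r s ^ 2) = sqrt (1 - rho s ^ 2) / r s).
  { intros s Hs. destruct (Hpt s Hs) as (_ & Hr & E). unfold h. rewrite <- E.
    rewrite sqrt_pow2 by lra. reflexivity. }
  set (sb := b / 2). assert (Hsb : 0 < sb < b) by (unfold sb; lra).
  assert (Hsb2 : 0 < r sb ^ 2) by (apply pow_lt, Hpt, Hsb).
  assert (Hprof : profile beta g (r sb ^ 2) h).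
  { split; [exact Hsb2|]. intros w Hw.
    destruct (Hrange sb w Hsb Hw) as (s & Hs & Ew).
    destruct (Hpt s ltac:(lra)) as (Hrho & Hr & EG).
    destruct (Hsol s (HDb s ltac:(lra))) as (_ & Dr & Dq).
    apply is_derive_Reals in Dr, Dq.
    assert (Hex : exists dG : R, is_derive G w dG).
    { apply (analytic_on_ex_derive _ G w HGan : _ -> ex_derive G w). rewrite <- Ew. split; nra. }
    destruct Hex as [dG HdG].
    (* Differentiating rho = G(r^2) with r' = rho expresses the derivative of G through [toyF]. *)
    assert (HdG' : 2 * rho s * r s * dG = toyF beta g (rho s) (r s)).
    { assert (HD2 : is_derive rho s (2 * rho s * r s * dG)).
      { apply (is_derive_ext_loc (fun x => G (r x ^ 2))).
        - assert (Hm : 0 < Rmin s (b - s)) by (apply Rmin_glb_lt; lra).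
          exists (mkposreal _ Hm). intros y Hy. change (Rabs (y - s) < Rmin s (b - s)) in Hy.
          pose proof (Rmin_l s (b - s)). pose proof (Rmin_r s (b - s)). apply Rabs_def2 in Hy.
          symmetry. apply Hpt. lra.
        - evar_last.
          + apply (is_derive_comp G (fun x => r x ^ 2)); [rewrite Ew; exact HdG|].
            apply (is_derive_pow r 2), Dq.
          + unfold scal; simpl; unfold mult; simpl. ring. }
      apply is_derive_unique in Dr. apply is_derive_unique in HD2. congruence. }
    assert (Esw : sqrt w = r s) by (rewrite <- Ew; apply sqrt_pow2; lra).
    assert (EGw : G w = rho s) by (rewrite <- Ew; symmetry; exact EG).
    assert (Hpos : 0 < 1 - rho s ^ 2) by nra.
    assert (HE : 0 < sqrt (1 - rho s ^ 2)) by (apply sqrt_lt_R0, Hpos).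
    assert (HEE : sqrt (1 - rho s ^ 2) * sqrt (1 - rho s ^ 2) = 1 - rho s ^ 2)
      by (apply sqrt_sqrt; lra).
    assert (Ehw : h w = sqrt (1 - rho s ^ 2) / r s) by (unfold h; rewrite Esw, EGw; reflexivity).
    assert (EN : h w ^ 2 * w = 1 - rho s ^ 2).
    { rewrite Ehw, <- Ew. transitivity (sqrt (1 - rho s ^ 2) * sqrt (1 - rho s ^ 2)); [field; lra|exact HEE]. }
    split; [rewrite Ehw; apply Rdiv_lt_0_compat; lra|]. split; [rewrite EN; nra|].
    unfold etaF. rewrite EN. replace (sqrt (1 - (1 - rho s ^ 2))) with (rho s)
      by (replace (1 - (1 - rho s ^ 2)) with (rho s ^ 2) by ring; symmetry; apply sqrt_pow2; lra).
    rewrite Ehw.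
    assert (HdG2 : dG = toyF beta g (rho s) (r s) / (2 * rho s * r s))
      by (rewrite <- HdG'; field; lra).
    unfold toyF in HdG2. rewrite Ew in HdG2.
    set (E := sqrt (1 - rho s ^ 2)) in *. rewrite <- HEE in HdG2.
    assert (Hw0 : 0 < w) by lra.
    assert (Hsqw : is_derive sqrt w (/ (2 * sqrt w))).
    { auto_derive; [exact Hw0|]. apply Rmult_1_l. }
    unfold h. evar_last.
    - apply (is_derive_div (fun w => sqrt (1 - G w ^ 2)) sqrt).
      + apply (is_derive_sqrt (fun w => 1 - G w ^ 2)).
        * apply (is_derive_minus (fun _ => 1) (fun w => G w ^ 2)); [apply is_derive_const|].
          apply (is_derive_pow G 2), HdG.
        * rewrite EGw. exact Hpos.
      + exact Hsqw.
      + rewrite Esw. lra.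
    - rewrite EGw, Esw, HdG2, <- Ew.
      fold E. unfold minus, plus, opp, zero; simpl.
      set (gv := g (r s * (r s * 1))).
      field. repeat split; lra. }
  assert (Leta' : lim_right0 h eta0).
  { intros e He. destruct (Leta e He) as (d' & Hd' & Hb').
    set (t := Rmin d' b / 2).
    assert (Ht : 0 < t /\ t < d' /\ t < b).
    { unfold t. pose proof (Rmin_l d' b). pose proof (Rmin_r d' b).
      assert (0 < Rmin d' b) by (apply Rmin_glb_lt; lra). lra. }
    (* Any w below r(t)^2 is r(s)^2 for some s < t, so the limit in s carries over to a limit in
       w. *)
    exists (r t ^ 2). split; [apply pow_lt, Hpt; lra|].
    intros w Hw. destruct (Hrange t w ltac:(lra) Hw) as (s & Hs & <-).
    rewrite Hh by lra. apply Hb'. lra. }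
  assert (E3 := profile_limit beta g _ eta0 h Hg Hprof He0 Leta'). subst eta0.
  destruct (Hrange sb (r sb ^ 2 / 2) Hsb ltac:(lra)) as (s & Hs & Es).
  exists s. destruct (Hpt s ltac:(lra)) as (Hrho & Hr & _).
  split; [apply HDb; lra|].
  assert (HWu : Wu beta g (sqrt (1 - rho s ^ 2) / r s) (r s ^ 2)).
  { rewrite <- Hh by lra. apply (profile_Wu beta g (r sb ^ 2)); [exact Hprof|exact Leta'|lra]. }
  split; [lra|]. split; [exact HWu|]. split; [apply HWu|apply pow_lt; lra].
Qed.

Lemma toy_tip_of_Wloc (beta : R) (g : R -> R) (lo hi : option R) (rho r : R -> R) (s0 : R) :
  analytic_on (fun _ => True) g -> toy_max_sol beta g lo hi rho r ->
  in_oint lo hi s0 -> Wloc beta g (rho s0) (r s0) ->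
  exists c, toy_tip beta g (fun s => in_oint lo hi (s + c))
                   (fun s => rho (s + c)) (fun s => r (s + c)).
Proof.
  intros Hg Hmax Hs0 HWl.
  destruct (canonical_tip beta g Hg)
    as (sig & eps & ps & rs & G & Hsig & Lrs & Hval & HGan & HG0 & HGpos & Leta & Hcan).
  destruct (Hcan lo hi rho r s0 Hmax Hs0 HWl) as (c & Hc).
  assert (Hsol : toy_sol beta g (in_oint lo hi) rho r) by apply Hmax.
  assert (Heps : 0 < eps).
  { destruct (Hval (sig / 2) ltac:(lra)) as (_ & H & _). pose proof (pow2_ge_0 (rs (sig / 2))). lra. }
  assert (Lr : lim_right0 (fun s => r (s + c)) 0).
  { apply (lim_right0_ext rs _ _ sig Hsig); [|exact Lrs]. intros s Hs. symmetry. apply Hc, Hs. }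
  assert (Lps : lim_right0 ps 1).
  { rewrite <- HG0. apply (lim_right0_ext (fun s => G (rs s * rs s)) _ _ sig Hsig).
    - intros s Hs. destruct (Hval s Hs) as (_ & _ & E). rewrite E. f_equal. ring.
    - replace 0 with (0 * 0) by ring.
      apply (lim_right0_comp (fun s => rs s * rs s) G); [apply lim_right0_mult; exact Lrs|].
      apply (ex_derive_continuous G), (analytic_on_ex_derive _ G _ HGan). lra. }
  (* At an interior time c continuity would give r c = 0, against r > 0 in M0. As the times just
     after c are interior, c must be the left end [lo]. *)
  assert (Hnc : ~ in_oint lo hi c).
  { intros Hin. destruct (Hsol c Hin) as ((_ & Hrc) & _ & Hder).
    assert (Lc : lim_right0 (fun s => r (s + c)) (r c)).
    { replace (r c) with ((fun s => r (s + c)) 0) by (cbv beta; f_equal; ring).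
      apply (lim_right0_comp (fun s => s) (fun s => r (s + c))); [apply lim_right0_id|].
      apply (continuous_comp (fun s => s + c) r).
      - apply (ex_derive_continuous (fun s => s + c)). auto_derive. trivial.
      - apply (ex_derive_continuous r). exists (rho c). apply is_derive_Reals.
        rewrite Rplus_0_l. exact Hder. }
    pose proof (lim_right0_unique _ _ _ Lr Lc). lra. }
  assert (Hlo : lo = Some c).
  { destruct (Hc (sig / 2) ltac:(lra)) as ((Hm1 & Hm2) & _).
    assert (Hhi : match hi with Some b => c < b | None => True end)
      by (destruct hi; [lra|trivial]).
    destruct lo as [l|].
    - assert (Hl : forall s, 0 < s < sig -> l < s + c) by (intros s Hs; apply Hc, Hs).
      destruct (Rtotal_order l c) as [Hlc|[Hlc|Hlc]].
      + exfalso. apply Hnc. split; assumption.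
      + subst. reflexivity.
      + exfalso. specialize (Hl (Rmin (sig / 2) (l - c))).
        pose proof (Rmin_l (sig / 2) (l - c)). pose proof (Rmin_r (sig / 2) (l - c)).
        assert (0 < Rmin (sig / 2) (l - c)) by (apply Rmin_glb_lt; lra). lra.
    - exfalso. apply Hnc. split; [trivial|assumption]. }
  exists c, (shift_end (- c) hi).
  assert (HDiff : forall s, in_oint lo hi (s + c) <-> in_oint (Some 0) (shift_end (- c) hi) s).
  { intros s. rewrite Hlo. destruct hi; unfold in_oint; simpl; split; intros [A B]; split; trivial; lra. }
  split; [exact HDiff|]. split; [exists (sig / 2); apply Hc; lra|].
  split; [apply toy_sol_shift, Hsol|].
  split.
  { apply (lim_right0_ext ps _ _ sig Hsig); [|exact Lps]. intros s Hs. symmetry. apply Hc, Hs. }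
  split; [exact Lr|]. split.
  { exists (1 / 3). split; [lra|].
    apply (lim_right0_ext (fun s => sqrt (1 - ps s ^ 2) / rs s) _ _ sig Hsig); [|exact Leta].
    intros s Hs. destruct (Hc s Hs) as (_ & -> & ->). reflexivity. }
  split.
  { exists (sig / 2), G. split; [lra|]. split; [apply Hc; lra|].
    destruct (Hc (sig / 2) ltac:(lra)) as (_ & _ & ->).
    destruct (Hval (sig / 2) ltac:(lra)) as (_ & H2 & _).
    split; [|split].
    - intros x0 Hx0. apply HGan. lra.
    - intros x Hx. apply HGpos. lra.
    - intros s Hs. destruct (Hc s ltac:(lra)) as (_ & -> & ->). apply Hval. lra. }
  (* The bracket in [toyF] is -1 plus this quantity, which tends to 1/3. A tolerance of 1/3 keeps it
     below 2/3, so rho' < 0 near the tip. *)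
  assert (LX : lim_right0 (fun s => sqrt (1 - ps s ^ 2) / rs s * (beta * (rs s * rs s) * g (rs s * rs s) + ps s))
            (1 / 3 * (beta * (0 * 0) * g (0 * 0) + 1))).
  { assert (L2 : lim_right0 (fun s => rs s * rs s) (0 * 0)) by (apply lim_right0_mult; exact Lrs).
    apply lim_right0_mult; [exact Leta|]. apply lim_right0_plus; [|exact Lps].
    apply lim_right0_mult; [apply lim_right0_mult; [apply lim_right0_const|exact L2]|].
    apply (lim_right0_comp (fun s => rs s * rs s) g); [exact L2|]. apply analytic_on_continuous, Hg. }
  destruct (LX (1 / 3) ltac:(lra)) as (d & Hd & HX).
  exists (Rmin d sig). split; [apply Rmin_glb_lt; assumption|].
  intros s Hs. pose proof (Rmin_l d sig). pose proof (Rmin_r d sig).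
  destruct (Hc s ltac:(lra)) as (Hin & Ep & Er).
  destruct (Hval s ltac:(lra)) as (Hrs & Hrs2 & EG).
  split; [exact Hin|]. split.
  { rewrite Ep, EG. apply HGpos. pose proof (pow2_ge_0 (rs s)). lra. }
  exists (toyF beta g (rho (s + c)) (r (s + c))). split.
  - apply (toy_sol_shift beta g (in_oint lo hi) rho r c Hsol s Hin).
  - destruct (Hsol (s + c) Hin) as ((Hr1 & _) & _). rewrite Ep in Hr1. rewrite Ep, Er.
    specialize (HX s ltac:(lra)). apply Rabs_def2 in HX.
    unfold toyF. replace (rs s ^ 2) with (rs s * rs s) by ring.
    set (Y := beta * (rs s * rs s) * g (rs s * rs s) + ps s) in *.
    replace (sqrt (1 - ps s ^ 2) * Y / rs s) with (sqrt (1 - ps s ^ 2) / rs s * Y) by (field; lra).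
    set (X := sqrt (1 - ps s ^ 2) / rs s * Y) in *.
    assert (HX1 : X < 1) by lra.
    assert (Hf : 0 < 3 / 2 * (1 - ps s ^ 2) / rs s) by (apply Rdiv_lt_0_compat; nra).
    nra.
Qed.

Theorem theoremA5 (g : R -> R) (beta : R) (lo hi : option R) (rho r : R -> R)
  (Hg : analytic_on (fun _ => True) g)
  (Hgpos : forall v, 0 < v -> 0 < g v)
  (Hy : toy_max_sol beta g lo hi rho r) :
  (exists c : R, toy_tip beta g (fun s => in_oint lo hi (s + c))
                   (fun s => rho (s + c)) (fun s => r (s + c)))
  <->
  (forall p q : R, (exists s, in_oint lo hi s /\ rho s = p /\ r s = q) <-> Wtip beta g p q).
Proof.
  split.
  - intros (c & Htip) p q.
    destruct (toy_tip_meets_Wloc beta g _ _ _ Hg Htip) as (s1 & Hs1 & HW1).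
    split.
    + intros (s & Hs & Ep & Eq). split.
      { subst. apply Hy, Hs. }
      (* The witness is y itself, translated so that the given point is at time 0. *)
      exists (shift_end (- s) lo), (shift_end (- s) hi),
        (fun x => rho (x + s)), (fun x => r (x + s)), (s1 + c - s).
      split; [apply toy_max_sol_shift, Hy|].
      split; [apply in_oint_shift; replace (0 - - s) with s by ring; exact Hs|].
      split; [rewrite Rplus_0_l; exact Ep|]. split; [rewrite Rplus_0_l; exact Eq|].
      split; [apply in_oint_shift; replace (s1 + c - s - - s) with (s1 + c) by ring; exact Hs1|].
      replace (s1 + c - s + s) with (s1 + c) by ring. exact HW1.
    + intros (_ & lo' & hi' & rho' & r' & s0 & Hmax' & H0 & E1 & E2 & Hs0 & HW0).
      destruct (canonical_tip beta g Hg)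
        as (sig & eps & ps & rs & G & Hsig & _ & _ & _ & _ & _ & _ & Hcan).
      destruct (Hcan lo hi rho r (s1 + c) Hy Hs1 HW1) as (c1 & Hc1).
      destruct (Hcan lo' hi' rho' r' s0 Hmax' Hs0 HW0) as (c2 & Hc2).
      (* Both maximal solutions contain the canonical germ; its point at time sig/2 is a common
         phase point, and any time in (0, sig) would serve. *)
      destruct (Hc1 (sig / 2) ltac:(lra)) as (I1 & P1 & Q1).
      destruct (Hc2 (sig / 2) ltac:(lra)) as (I2 & P2 & Q2).
      destruct (toy_max_sol_contains beta g lo hi lo' hi' rho r rho' r' _ _ Hg Hy
        (proj1 (proj2 Hmax')) I1 I2) with (u := 0) as (A & B & C); [congruence|congruence|exact H0|].
      eexists. split; [exact A|]. split; congruence.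
  - intros Hrange.
    destruct Hy as ((s & Hs) & Hsol & Hext). assert (Hy : toy_max_sol beta g lo hi rho r).
    { split; [exists s; exact Hs|]. split; assumption. }
    destruct (proj1 (Hrange (rho s) (r s))) as
      (_ & lo' & hi' & rho' & r' & s0 & Hmax' & H0 & E1 & E2 & Hs0 & HW0).
    { exists s. repeat split; apply Hs. }
    (* The orbit that witnesses membership in W^tip shares a point with y, so y passes through the
       same point of W^loc. *)
    destruct (toy_max_sol_contains beta g lo hi lo' hi' rho r rho' r' s 0 Hg Hy
        (proj1 (proj2 Hmax')) Hs H0) with (u := s0) as (A & B & C);
      [congruence|congruence|exact Hs0|].
    apply (toy_tip_of_Wloc beta g lo hi rho r _ Hg Hy A). rewrite B, C. exact HW0.
Qed.
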